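(* Let $\mathcal{A}$ be a countable structure in a relational language and let $n\geq 1$ be finite. Suppose that for every $Z\subseteq\omega$ there are $Z$-computable copies $\mathcal{B}_Z,\mathcal{C}_Z$ of $\mathcal{A}$ such that no isomorphism $f\colon\mathcal{B}_Z\to\mathcal{C}_Z$ satisfies $f\leq_T Z^{(n-1)}$. Then some automorphism orbit of a finite tuple of $\mathcal{A}$ is not $\Sigma^{\mathrm{in}}_{n}$-definable (without parameters); consequently $\mathcal{A}$ has no $\Pi^{\mathrm{in}}_{n+1}$ Scott sentence and $\operatorname{SR}(\mathcal{A})\geq n+1$.
   Context: $Z^{(k)}$ denotes the $k$-th Turing jump of $Z$. A $Z$-computable copy of $\mathcal{A}$ is a structure isomorphic to $\mathcal{A}$ whose universe is a $Z$-computable subset of $\omega$ and whose relations are (uniformly) $Z$-computable. Infinitary formulas (of $L_{\omega_1\omega}$): $\Sigma^{\mathrm{in}}_0=\Pi^{\mathrm{in}}_0$ are the finitary quantifier-free formulas; for $\alpha\geq1$, a $\Sigma^{\mathrm{in}}_\alpha$ formula is a countable disjunction of formulas $\exists\bar y\,\psi$ with $\psi\in\Pi^{\mathrm{in}}_\beta$, $\beta<\alpha$, and a $\Pi^{\mathrm{in}}_\alpha$ formula is a countable conjunction of formulas $\forall\bar y\,\psi$ with $\psi\in\Sigma^{\mathrm{in}}_\beta$, $\beta<\alpha$; all formulas have finitely many free variables. A Scott sentence of a countable structure $\mathcal{A}$ is an $L_{\omega_1\omega}$ sentence whose countable models are exactly the isomorphic copies of $\mathcal{A}$. The automorphism orbit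 of a finite tuple $\bar a$ is $\{g(\bar a): g\in\operatorname{Aut}(\mathcal{A})\}$. The Scott rank $\operatorname{SR}(\mathcal{A})$ is the least $\alpha$ such that every automorphism orbit of every finite tuple of $\mathcal{A}$ is definable by a $\Sigma^{\mathrm{in}}_\alpha$ formula without parameters. *)

(* Defs.v *)
From HB Require Import structures.
From mathcomp Require Import all_boot all_classical.
Set Implicit Arguments.
Unset Strict Implicit.
Unset Printing Implicit Defensive.
Local Open Scope classical_set_scope.

(* Cantor's pairing bijection: (x + y)(x + y + 1) / 2 + y. *)
Definition cpair (x y : nat) : nat := 'C((x + y).+1, 2) + y.

Fixpoint cseq (s : seq nat) : nat :=
  if s is x :: s' then (cpair x (cseq s')).+1 else 0.

(* Partial recursive functions with an oracle, presented as unary functions;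
   several arguments are passed through [cpair]. *)
Inductive prog : Type :=
| pZero | pSucc | pFst | pSnd | pOracle
| pPair of prog & prog
| pComp of prog & prog
| pPrec of prog & prog
| pMu of prog.

(* [eval Z p x y]: the program p with oracle Z halts on input x with output y. *)
Inductive eval (Z : set nat) : prog -> nat -> nat -> Prop :=
| ev_zero x : eval Z pZero x 0
| ev_succ x : eval Z pSucc x x.+1
| ev_fst x y : eval Z pFst (cpair x y) x
| ev_snd x y : eval Z pSnd (cpair x y) y
| ev_oracle1 x : Z x -> eval Z pOracle x 1
| ev_oracle0 x : ~ Z x -> eval Z pOracle x 0
| ev_pair p q x y z :
    eval Z p x y -> eval Z q x z -> eval Z (pPair p q) x (cpair y z)
| ev_comp p q x y z :
    eval Z q x y -> eval Z p y z -> eval Z (pComp p q) x z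
| ev_prec0 p q a y : eval Z p a y -> eval Z (pPrec p q) (cpair a 0) y
| ev_precS p q a m y z :
    eval Z (pPrec p q) (cpair a m) y -> eval Z q (cpair a (cpair m y)) z ->
    eval Z (pPrec p q) (cpair a m.+1) z
| ev_mu p a m (w : nat -> nat) :
    (forall k, k < m -> eval Z p (cpair a k) (w k).+1) ->
    eval Z p (cpair a m) 0 -> eval Z (pMu p) a m.

Fixpoint gnum (p : prog) : nat :=
  match p with
  | pZero => cpair 0 0
  | pSucc => cpair 1 0
  | pFst => cpair 2 0
  | pSnd => cpair 3 0
  | pOracle => cpair 4 0
  | pPair p q => cpair 5 (cpair (gnum p) (gnum q))
  | pComp p q => cpair 6 (cpair (gnum p) (gnum q))
  | pPrec p q => cpair 7 (cpair (gnum p) (gnum q))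
  | pMu p => cpair 8 (gnum p)
  end.

Definition decides (Z : set nat) (p : prog) (x : nat) (P : Prop) : Prop :=
  (P -> eval Z p x 1) /\ (~ P -> eval Z p x 0).

Definition computable_set (Z X : set nat) : Prop :=
  exists p, forall x, decides Z p x (X x).

(* Numbers that are not of the form [gnum p] index the nowhere defined function. *)
Definition jump (Z : set nat) : set nat :=
  [set e | exists p, gnum p = e /\ exists y, eval Z p e y].

Definition jumps (k : nat) (Z : set nat) : set nat := iter k jump Z.

(* The symbol s has Goedel number [pickle s]; as [symb] is an arbitrary
   countType, every numbering of the symbols is covered. *)
Record language := Language { symb : countType ; arity : symb -> nat }.

Record structure (L : language) := Structure {
  carrier :> Type;
  rel_of : forall s : symb L, (arity s).-tuple carrier -> Prop }.

Definition is_isomorphism (L : language) (A B : structure L) (f : A -> B) : Prop :=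
  bijective f /\
  forall (s : symb L) (t : (arity s).-tuple A),
    rel_of t <-> rel_of (map_tuple f t).

Definition isomorphic (L : language) (A B : structure L) : Prop :=
  exists f : A -> B, is_isomorphism f.

Definition orbit_of (L : language) (A : structure L) (k : nat) (a : k.-tuple A) :
    set (k.-tuple A) :=
  [set b | exists g : A -> A, is_isomorphism g /\ b = map_tuple g a].

(* Structures whose universe is a subset of omega. *)
Record nat_structure (L : language) := NatStructure {
  univ : set nat;
  nrel : forall s : symb L, (arity s).-tuple univ -> Prop }.

Definition structure_of (L : language) (B : nat_structure L) : structure L :=
  Structure (@nrel L B).
Coercion structure_of : nat_structure >-> structure.

(* A single program decides all relations, given the symbol and the tuple. *)
Definition computable_structure (L : language) (Z : set nat) (B : nat_structure L) :
    Prop :=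
  computable_set Z (univ B) /\
  exists p, forall (s : symb L) (t : (arity s).-tuple (univ B)),
    decides Z p (cpair (pickle s) (cseq [seq val x | x <- t])) (nrel t).

Definition computable_copy (L : language) (Z : set nat) (A : structure L)
    (B : nat_structure L) : Prop :=
  computable_structure Z B /\ isomorphic A B.

(* When [univ B] is Z-computable, this is equivalent to Z-computability of the
   graph of f as a set of pairs of numbers. *)
Definition computable_map (L : language) (Z : set nat) (B C : nat_structure L)
    (f : B -> C) : Prop :=
  exists p, forall x : univ B, eval Z p (val x) (val (f x : univ C)).

(* [Osup f] denotes the least ordinal greater than all [f i]; distinct terms
   may denote the same ordinal, and [ole] compares the denoted ordinals. *)
Inductive ord : Type := Osup (T : Type) (f : T -> ord).

HB.instance Definition _ := gen_eqMixin ord.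
HB.instance Definition _ := gen_choiceMixin ord.

Fixpoint ole (a b : ord) : Prop :=
  let: Osup T f := a in
  forall i : T, let: Osup U g := b in exists j : U, ole (f i) (g j).

Definition osucc (a : ord) : ord := Osup (fun _ : unit => a).

Definition olt (a b : ord) : Prop := ole (osucc a) b.

Definition ozero : ord := Osup (fun i : void => match i with end).

Definition ofin (n : nat) : ord := iter n osucc ozero.

(* [formula L n]: formulas of L_{omega_1 omega} with free variables indexed by
   'I_n. Quantifiers bind variable 0 and shift the others. Conjunctions and
   disjunctions range over the indices j in the set J, which may be finite or
   empty; the values of the family outside J are irrelevant. *)
Inductive formula (L : language) : nat -> Type :=
| fRel n (s : symb L) (v : (arity s).-tuple 'I_n) : formula L n
| fEq n (i j : 'I_n) : formula L n
| fNot n : formula L n -> formula L n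
| fConj n (J : set nat) : (nat -> formula L n) -> formula L n
| fDisj n (J : set nat) : (nat -> formula L n) -> formula L n
| fAll n : formula L n.+1 -> formula L n
| fEx n : formula L n.+1 -> formula L n.

Fixpoint sat (L : language) (A : structure L) (n : nat) (phi : formula L n) :
    n.-tuple A -> Prop :=
  match phi in formula _ m return m.-tuple A -> Prop with
  | fRel _ s v => fun e => rel_of (map_tuple (tnth e) v)
  | fEq _ i j => fun e => tnth e i = tnth e j
  | fNot _ psi => fun e => ~ sat psi e
  | fConj _ J psi => fun e => forall j, J j -> sat (psi j) e
  | fDisj _ J psi => fun e => exists j, J j /\ sat (psi j) e
  | fAll _ psi => fun e => forall a : A, sat psi (cons_tuple a e)
  | fEx _ psi => fun e => exists a : A, sat psi (cons_tuple a e)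
  end.

Fixpoint fAlls (L : language) (k n : nat) : formula L (k + n) -> formula L n :=
  match k return formula L (k + n) -> formula L n with
  | 0 => id
  | k'.+1 => fun phi => fAlls (fAll phi)
  end.

Fixpoint fExs (L : language) (k n : nat) : formula L (k + n) -> formula L n :=
  match k return formula L (k + n) -> formula L n with
  | 0 => id
  | k'.+1 => fun phi => fExs (fEx phi)
  end.

Inductive finitary_qf (L : language) : forall n, formula L n -> Prop :=
| qf_rel n (s : symb L) (v : (arity s).-tuple 'I_n) : finitary_qf (fRel v)
| qf_eq n (i j : 'I_n) : finitary_qf (fEq L i j)
| qf_not n (phi : formula L n) : finitary_qf phi -> finitary_qf (fNot phi)
| qf_conj n (J : set nat) (phi : nat -> formula L n) :
    finite_set J -> (forall j, J j -> finitary_qf (phi j)) ->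
    finitary_qf (fConj J phi)
| qf_disj n (J : set nat) (phi : nat -> formula L n) :
    finite_set J -> (forall j, J j -> finitary_qf (phi j)) ->
    finitary_qf (fDisj J phi).

(* As [ord] is not quotiented, alpha = 0 and alpha >= 1 are expressed by [ole]. *)
Inductive Sigma_in (L : language) : ord -> forall n, formula L n -> Prop :=
| Sigma_qf alpha n (phi : formula L n) :
    ole alpha ozero -> finitary_qf phi -> Sigma_in alpha phi
| Sigma_disj alpha n (J : set nat) (k : nat -> nat) (beta : nat -> ord)
    (psi : forall j, formula L (k j + n)) :
    ole (ofin 1) alpha ->
    (forall j, J j -> olt (beta j) alpha /\ Pi_in (beta j) (psi j)) ->
    Sigma_in alpha (fDisj J (fun j => fExs (psi j)))
with Pi_in (L : language) : ord -> forall n, formula L n -> Prop :=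
| Pi_qf alpha n (phi : formula L n) :
    ole alpha ozero -> finitary_qf phi -> Pi_in alpha phi
| Pi_conj alpha n (J : set nat) (k : nat -> nat) (beta : nat -> ord)
    (psi : forall j, formula L (k j + n)) :
    ole (ofin 1) alpha ->
    (forall j, J j -> olt (beta j) alpha /\ Sigma_in (beta j) (psi j)) ->
    Pi_in alpha (fConj J (fun j => fAlls (psi j))).

Definition Sigma_definable (L : language) (A : structure L) (alpha : ord) (k : nat)
    (S : set (k.-tuple A)) : Prop :=
  exists phi : formula L k, Sigma_in alpha phi /\ S = [set b | sat phi b].

Definition Scott_sentence (L : language) (A : structure L) (phi : formula L 0) : Prop :=
  forall B : structure L, countable [set: B] ->
    (sat phi [tuple of [::] : seq B] <-> isomorphic A B).

Definition orbits_definable (L : language) (A : structure L) (alpha : ord) : Prop :=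
  forall (k : nat) (a : k.-tuple A), Sigma_definable alpha (orbit_of a).

Definition is_Scott_rank (L : language) (A : structure L) (alpha : ord) : Prop :=
  orbits_definable A alpha /\
  forall beta, orbits_definable A beta -> ole alpha beta.

(* By Scott's theorem a least such ordinal exists for every countable A, so the
   default value [ozero] is never taken for countable A. *)
Definition Scott_rank (L : language) (A : structure L) : ord :=
  xget ozero [set alpha | is_Scott_rank A alpha].

(* Main.v *)
Require Import Defs.
From mathcomp Require Import all_boot all_classical.
From mathcomp Require Import zify.
Set Implicit Arguments.
Unset Strict Implicit.
Unset Printing Implicit Defensive.
Local Open Scope classical_set_scope.

(** Everything reduces to one fact: if all automorphism orbits of A were
Sigma_n definable, then, for all oracles Z above some fixed one, any two
Z-computable copies of A would be isomorphic by a map computable from the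
(n-1)-st jump of Z ([computable_isomorphism]). This contradicts the hypothesis
on copies, so some orbit is not Sigma_n definable. A Pi_(n+1) Scott sentence,
and equally a Scott rank below n+1, would make all orbits Sigma_n definable.

Effective part. Being above a fixed oracle means that any given function on
numbers, or any countable family of formulas, may be assumed to be computable;
[on_cone] expresses this. In a Z-computable structure, truth of a countable
family of formulas of finite level m is then decidable from the m-th jump of Z
([level_truths]). For level 0 this is a finite table, since a finitary
quantifier-free formula depends on finitely many atomic facts. For the next
level, a formula or its negation is a search over the previous level, and one
more jump decides whether a search succeeds. Given Sigma_n definitions of the
orbits, two tuples from copies B and C correspond under some isomorphism if and
only if they satisfy a common definition, which is a search over a relation
decidable from the (n-1)-st jump of Z. A back-and-forth construction in which
each step is such a search never gets stuck, and produces the isomorphism.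

Scott sentences. Let A have a Pi_(alpha+1) Scott sentence, with alpha at least
1. For every tuple a some Sigma_alpha formula true of a implies in A the whole
Pi_alpha type of a ([exists_support]): otherwise a Henkin construction
([omitting_types]), whose conditions are finite sets of formulas Pi of rank
below alpha satisfied in A, yields a countable model of the sentence with no
tuple realizing that type, although the model is isomorphic to A. Two tuples
linked by such a supporting formula have the same Sigma_alpha type, and tuples
of the same type are automorphic by back-and-forth, so the supporting formulas
define the orbits ([Scott_sentence_orbits_definable]).

Scott rank. [Scott_rank] is defined by a choice, so its defining property has
to be established: Scott's analysis produces an ordinal
alpha such that all orbits are Sigma_alpha definable, and ordinals are
well-founded ([Scott_rankP]). *)

(** * Pairing and lists *)

Lemma cpair_step x y : cpair x.+1 y = (cpair x y.+1).-1.
Proof. by rewrite /cpair !addSn !addnS. Qed.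

Lemma cpair_diag y : cpair y.+1 0 = (cpair 0 y).+1.
Proof. by rewrite /cpair addn0 add0n addn0 binS bin1 addnS. Qed.

Lemma cpair_bounds x y :
  'C((x + y).+1, 2) <= cpair x y < 'C((x + y).+2, 2).
Proof. by rewrite /cpair leq_addr (binS (x + y).+1) bin1 addnC -addnS; lia. Qed.

Lemma cpair_inj x y x' y' : cpair x y = cpair x' y' -> x = x' /\ y = y'.
Proof.
move=> e; have exy : x + y = x' + y'.
  have /andP[l1 u1] := cpair_bounds x y.
  have /andP[l2 u2] := cpair_bounds x' y'.
  apply/eqP; rewrite eqn_leq; apply/andP; split; rewrite leqNgt; apply/negP => lt.
    have : 'C((x' + y').+2, 2) <= 'C((x + y).+1, 2) by apply: leq_bin2l.
    lia.
  have : 'C((x + y).+2, 2) <= 'C((x' + y').+1, 2) by apply: leq_bin2l.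
  lia.
move: e; rewrite /cpair exy => /addnI ey; split=> //; lia.
Qed.

(** The enumeration of pairs that [cpair] inverts: down each diagonal, then to the
start of the next one. *)
Definition unpair (z : nat) : nat * nat :=
  iter z (fun u => if u.1 is x.+1 then (x, u.2.+1) else (u.2.+1, 0)) (0, 0).
Definition cfst z := (unpair z).1.
Definition csnd z := (unpair z).2.

Lemma cpair_eta z : cpair (cfst z) (csnd z) = z.
Proof.
rewrite /cfst /csnd; elim: z => [//|z IH].
rewrite /unpair iterS -/(unpair z); case: (unpair z) IH => [[|x] y] /= IH.
  by rewrite cpair_diag IH.
by rewrite -IH cpair_step prednK // /cpair addnS.
Qed.

Lemma cfst_pair x y : cfst (cpair x y) = x.
Proof. by have [] := cpair_inj (cpair_eta (cpair x y)). Qed.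

Lemma csnd_pair x y : csnd (cpair x y) = y.
Proof. by have [] := cpair_inj (cpair_eta (cpair x y)). Qed.

Definition cpairE := (cfst_pair, csnd_pair, cpair_eta).

Lemma leq_csnd x y : y <= cpair x y.
Proof. exact: leq_addl. Qed.

Lemma cseq_inj : injective cseq.
Proof.
by elim=> [|x s IH] [|y t] //= [] /cpair_inj[-> /IH ->].
Qed.

Lemma cseq_surj c : exists s, cseq s = c.
Proof.
elim/ltn_ind: c => [[|c]] IH; first by exists [::].
have [|s es] := IH (csnd c); first by rewrite ltnS -{2}(cpair_eta c) leq_csnd.
by exists (cfst c :: s); rewrite /= es cpair_eta.
Qed.

(** Chosen rather than programmed: functions on codes of lists are only ever
computed with the help of an oracle that contains them. *)
Definition dseq c : seq nat := projT1 (cid (cseq_surj c)).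

Lemma dseqK c : cseq (dseq c) = c.
Proof. exact: projT2 (cid (cseq_surj c)). Qed.

Lemma cseqK s : dseq (cseq s) = s.
Proof. by apply: cseq_inj; rewrite dseqK. Qed.

(** * Oracle computations *)

Lemma gnum_inj : injective gnum.
Proof.
elim=> [|||||p IHp q IHq|p IHp q IHq|p IHp q IHq|p IHp]
       [|||||p' q'|p' q'|p' q'|p'] //= /cpair_inj[] //.
- by move=> _ e; case: (cpair_inj e) => e1 e2; rewrite (IHp _ e1) (IHq _ e2).
- by move=> _ e; case: (cpair_inj e) => e1 e2; rewrite (IHp _ e1) (IHq _ e2).
- by move=> _ e; case: (cpair_inj e) => e1 e2; rewrite (IHp _ e1) (IHq _ e2).
- by move=> _ e; rewrite (IHp _ e).
Qed.

Ltac invert_eval h :=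
  inversion h; clear h; subst;
  repeat match goal with e : cpair _ _ = cpair _ _ |- _ =>
    apply cpair_inj in e; destruct e; subst; try discriminate
  end.

(** Without determinism, a halting search could not be known to have stopped at a
value with the property searched for, nor membership in a jump be analysed. *)
Lemma eval_det Z p x y y' : eval Z p x y -> eval Z p x y' -> y = y'.
Proof.
move=> h; elim: h y' => {p x y}.
- by move=> x y' h; invert_eval h.
- by move=> x y' h; invert_eval h.
- by move=> x y y' h; invert_eval h.
- by move=> x y y' h; invert_eval h.
- by move=> x Zx y' h; invert_eval h.
- by move=> x Zx y' h; invert_eval h.
- move=> p q x y z _ IHp _ IHq y' h; invert_eval h.
  match goal with h1 : eval Z p x _, h2 : eval Z q x _ |- _ =>
    by rewrite (IHp _ h1) (IHq _ h2) end.
- move=> p q x y z _ IHq _ IHp y' h; invert_eval h.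
  match goal with h1 : eval Z q x _, h2 : eval Z p _ _ |- _ =>
    by rewrite -(IHq _ h1) in h2; apply: IHp end.
- by move=> p q a y _ IHp y' h; invert_eval h; apply: IHp.
- move=> p q a m y z _ IHp _ IHq y' h; invert_eval h.
  match goal with e : _.+1 = _.+1 |- _ => move: e => [e]; subst end.
  match goal with h1 : eval Z (pPrec p q) _ _, h2 : eval Z q _ _ |- _ =>
    by rewrite -(IHp _ h1) in h2; apply: IHq end.
- move=> p a m w _ IHw _ IH0 y' h; inversion h as [| | | | | | | | | |? ? ? w' h1 h2]; subst.
  apply/eqP; rewrite eqn_leq; apply/andP; split; rewrite leqNgt; apply/negP => lt.
    by have := IHw _ lt _ h2.
  by have := IH0 _ (h1 _ lt).
Qed.

Fixpoint subst_oracle (q p : prog) : prog :=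
  match p with
  | pOracle => q
  | pPair p1 p2 => pPair (subst_oracle q p1) (subst_oracle q p2)
  | pComp p1 p2 => pComp (subst_oracle q p1) (subst_oracle q p2)
  | pPrec p1 p2 => pPrec (subst_oracle q p1) (subst_oracle q p2)
  | pMu p1 => pMu (subst_oracle q p1)
  | _ => p
  end.

(** Transitivity of Turing reducibility, at the level of programs. *)
Lemma eval_subst X Y q p x y : (forall x, decides Y q x (X x)) ->
  eval X p x y -> eval Y (subst_oracle q p) x y.
Proof.
move=> hq; elim=> {p x y} /=; try by econstructor; eauto.
- by move=> x /(proj1 (hq x)).
- by move=> x /(proj2 (hq x)).
Qed.

Definition cfun (Z : set nat) (f : nat -> nat) : Prop :=
  exists p, forall x, eval Z p x (f x).

Lemma cfun_ext Z f g : f =1 g -> cfun Z f -> cfun Z g.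
Proof. by move=> e [p hp]; exists p => x; rewrite -e. Qed.

Lemma cfun_fst Z : cfun Z cfst.
Proof. by exists pFst => x; rewrite -{1}(cpair_eta x); constructor. Qed.

Lemma cfun_snd Z : cfun Z csnd.
Proof. by exists pSnd => x; rewrite -{1}(cpair_eta x); constructor. Qed.

Lemma cfun_pair Z f g : cfun Z f -> cfun Z g -> cfun Z (fun x => cpair (f x) (g x)).
Proof. by move=> [p hp] [q hq]; exists (pPair p q) => x; constructor. Qed.

Lemma cfun_comp Z f g : cfun Z f -> cfun Z g -> cfun Z (fun x => f (g x)).
Proof.
by move=> [p hp] [q hq]; exists (pComp p q) => x; apply: ev_comp (hq x) (hp _).
Qed.

Lemma cfun_id Z : cfun Z id.
Proof.
by apply: cfun_ext (cfun_pair (cfun_fst Z) (cfun_snd Z)) => x; rewrite cpair_eta.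
Qed.

Fixpoint pconst (k : nat) : prog :=
  if k is k'.+1 then pComp pSucc (pconst k') else pZero.

Lemma eval_const Z k x : eval Z (pconst k) x k.
Proof. by elim: k => [|k IH] /=; econstructor; eauto; constructor. Qed.

Lemma cfun_const Z k : cfun Z (fun=> k).
Proof. by exists (pconst k) => x; apply: eval_const. Qed.

Lemma cfun_prec Z (f g : nat -> nat) (F : nat -> nat -> nat) :
  cfun Z f -> cfun Z g -> (forall a, F a 0 = f a) ->
  (forall a m, F a m.+1 = g (cpair a (cpair m (F a m)))) ->
  cfun Z (fun x => F (cfst x) (csnd x)).
Proof.
move=> [p hp] [q hq] F0 FS; exists (pPrec p q) => x.
rewrite -{1}(cpair_eta x); move: (cfst x) (csnd x) => a m.
elim: m => [|m IH]; first by rewrite F0; constructor.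
by rewrite FS; apply: ev_precS IH (hq _).
Qed.

Lemma cfun_oracle X Y f : computable_set Y X -> cfun X f -> cfun Y f.
Proof.
move=> [q hq] [p hp]; exists (subst_oracle q p) => x.
exact: eval_subst hq (hp x).
Qed.

Lemma computable_setP Z S : computable_set Z S <-> cfun Z (fun x => nat_of_bool `[<S x>]).
Proof.
split=> -[p hp]; exists p => x.
  by case: (asboolP (S x)) => h; [apply: (proj1 (hp x))|apply: (proj2 (hp x))].
by have := hp x; case: (asboolP (S x)).
Qed.

Lemma dec_ext Z S T : (forall x, S x <-> T x) -> computable_set Z S ->
  computable_set Z T.
Proof. by move=> e; suff -> : S = T by []; apply/seteqP; split=> x /e. Qed.

Lemma dec_preim Z S f : cfun Z f -> computable_set Z S ->
  computable_set Z [set x | S (f x)].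
Proof. by move=> cf /computable_setP cS; apply/computable_setP; apply: cfun_comp cS cf. Qed.

Lemma dec_not Z S : computable_set Z S -> computable_set Z [set x | ~ S x].
Proof.
move=> /computable_setP cS; apply/computable_setP.
pose F (a m : nat) := nat_of_bool (m == 0).
have cF : cfun Z (fun x => F (cfst x) (csnd x)).
  exact: (cfun_prec (cfun_const Z 1) (cfun_const Z 0)).
apply: cfun_ext (cfun_comp cF (cfun_pair cS cS)) => x.
by rewrite csnd_pair /F asbool_neg; case: asboolP.
Qed.

(** Primitive recursion up to the truth value of the guard runs the guarded
program only where the guard holds, so that program may diverge elsewhere. *)
Lemma dec_guard Z G P : computable_set Z G ->
  (exists p, forall x, G x -> decides Z p x (P x)) ->
  computable_set Z [set x | G x /\ P x].
Proof.
move=> /computable_setP[g hg] [p hp].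
have [i hi] := cfun_id Z.
exists (pComp (pPrec pZero (pComp p pFst)) (pPair i g)) => x.
have run y : eval Z (pPrec pZero (pComp p pFst)) (cpair x `[<G x>]) y ->
    eval Z (pComp (pPrec pZero (pComp p pFst)) (pPair i g)) x y.
  by move=> h; apply: ev_comp h; constructor.
have yes y : G x -> eval Z p x y ->
    eval Z (pPrec pZero (pComp p pFst)) (cpair x `[<G x>]) y.
  move=> Gx h; rewrite asboolT //=; apply: ev_precS; first by do 2 constructor.
  by apply: ev_comp h; constructor.
split=> [[Gx Px]|h]; apply: run; first by apply: yes => //; apply: (proj1 (hp x Gx)).
case: (pselect (G x)) => Gx.
  by apply: yes => //; apply: (proj2 (hp x Gx)) => Px; apply: h.
by rewrite asboolF //; do 2 constructor.
Qed.

Lemma dec_and Z S T : computable_set Z S -> computable_set Z T ->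
  computable_set Z [set x | S x /\ T x].
Proof. by move=> cS [p hp]; apply: dec_guard cS _; exists p. Qed.

Lemma dec_imp Z S T : computable_set Z S -> computable_set Z T ->
  computable_set Z [set x | S x -> T x].
Proof.
move=> cS cT; apply: dec_ext (dec_not (dec_and cS (dec_not cT))) => x /=.
by split=> [h Sx|h [/h]//]; apply: contrapT => nT; apply: h.
Qed.

Lemma eval_mu Z p (R : nat -> Prop) a m :
  (forall k, decides Z p (cpair a k) (~ R k)) ->
  R m -> (forall k, k < m -> ~ R k) -> eval Z (pMu p) a m.
Proof.
move=> hp Rm least; apply: (@ev_mu _ _ _ _ (fun=> 0)) => [k lt|].
  exact: (proj1 (hp k)) (least k lt).
by apply: (proj2 (hp m)).
Qed.

(** Any function becomes computable by a search in its graph; this is how a cone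
of oracles is seen to be nonempty. *)
Lemma cfun_graph g : cfun [set cpair x (g x) | x in setT] g.
Proof.
set Z := [set _ | _ in _].
have [q hq] : computable_set Z [set x | ~ Z x].
  by apply: dec_not; exists pOracle => x; split=> h; constructor.
have ZP x k : Z (cpair x k) <-> g x = k.
  by split=> [[y _ /cpair_inj[<-]]//|<-]; exists x.
exists (pMu q) => x.
apply: (@eval_mu _ _ (fun k => Z (cpair x k))) => [k||k lt].
- exact: hq.
- exact/ZP.
- by move/ZP => e; rewrite e ltnn in lt.
Qed.

(** A search halts exactly if it succeeds, so the jump knows the answer once it
is given the index of the search; that index is computable from x because the
numbers of the programs for constants are primitive recursive. *)
Lemma dec_jump Y S : computable_set Y S ->
  computable_set (jump Y) [set x | exists w, S (cpair x w)].
Proof.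
move=> /dec_not[p hp]; set q := pMu p.
have halt x z : (exists y, eval Y (pComp q (pconst x)) z y) <->
    exists w, S (cpair x w).
  split=> [[y h]|ex].
    inversion h as [| | | | | | |? ? ? x' ? h1 h2| | |]; subst.
    have ? := eval_det h1 (eval_const Y x z); subst x'.
    inversion h2 as [| | | | | | | | | |? ? ? w' h3 h4]; subst.
    exists y; apply: contrapT => nS.
    by have := eval_det h4 (proj1 (hp _) nS).
  have exb : exists w, `[<S (cpair x w)>] by have [w Sw] := ex; exists w; apply/asboolP.
  have := ex_minnP exb; case=> m /asboolP Sm least.
  exists m; apply: ev_comp (eval_const Y x z) _.
  apply: (@eval_mu _ _ (fun k => S (cpair x k))) => // k lt Sk.
  by have := least k (asboolT Sk); rewrite leqNgt lt.
pose F (a m : nat) := gnum (pconst m).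
have cF : cfun (jump Y) (fun x => F (cfst x) (csnd x)).
  apply: (@cfun_prec _ (fun=> gnum pZero)
    (fun x => cpair 6 (cpair (gnum pSucc) (csnd (csnd x))))) => //.
  - exact: cfun_const.
  - do 2 (apply: cfun_pair; first exact: cfun_const).
    by apply: cfun_comp; apply: cfun_snd.
  - by move=> a m; rewrite /F /= !cpairE.
have cG : cfun (jump Y) (fun x => gnum (pComp q (pconst x))).
  do 2 (apply: cfun_pair; first exact: cfun_const).
  apply: cfun_ext (cfun_comp cF (cfun_pair (cfun_id _) (cfun_id _))) => x.
  by rewrite /F csnd_pair.
have cJ : computable_set (jump Y) (jump Y).
  by exists pOracle => x; split=> h; constructor.
apply: dec_ext (dec_preim cG cJ) => x /=.
rewrite -(halt x (gnum (pComp q (pconst x)))); split=> [[p' [e]]|h].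
  by rewrite (@gnum_inj p' (pComp q (pconst x)) e).
by exists (pComp q (pconst x)).
Qed.

Lemma jump_self Y : computable_set (jump Y) Y.
Proof.
have cY : computable_set Y Y by exists pOracle => x; split=> h; constructor.
apply: dec_ext (dec_jump (dec_preim (cfun_fst Y) cY)) => x /=.
by split=> [[w]|h]; [|exists 0]; rewrite cfst_pair.
Qed.

Lemma cfun_jumps m Y f : cfun Y f -> cfun (jumps m Y) f.
Proof.
by elim: m => [//|m IH] /IH; apply: cfun_oracle; apply: jump_self.
Qed.

Lemma dec_jumps m Y S : computable_set Y S -> computable_set (jumps m Y) S.
Proof. by move=> /computable_setP /(cfun_jumps m) /computable_setP. Qed.

(** * Cones of oracles *)

(** Above the oracle g, which may encode any countable information, only the
functions that depend on a structure or on a jump need a program. *)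
Definition on_cone (P : set nat -> Prop) : Prop :=
  exists g, forall Z, cfun Z g -> P Z.

Lemma on_cone_fun f P : on_cone (fun Z => cfun Z f -> P Z) -> on_cone P.
Proof.
move=> [g hg]; exists (fun x => cpair (f x) (g x)) => Z h.
apply: hg.
  by apply: cfun_ext (cfun_comp (cfun_snd Z) h) => x; rewrite cpairE.
by apply: cfun_ext (cfun_comp (cfun_fst Z) h) => x; rewrite cpairE.
Qed.

Lemma on_cone_mp P Q : on_cone P -> on_cone (fun Z => P Z -> Q Z) -> on_cone Q.
Proof.
move=> [g hg] [f hf]; apply: (on_cone_fun (f := g)); exists f => Z hZ h.
by apply: hf => //; apply: hg.
Qed.

Lemma on_coneT (P : set nat -> Prop) : (forall Z, P Z) -> on_cone P.
Proof. by move=> h; exists id. Qed.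

Definition answers (S : set nat) (q : nat -> nat -> nat) x k : seq bool :=
  [seq `[<S (q x l)>] | l <- iota 0 k].

(** Truth-table reducibility: the answers to queries computable from x are
collected by primitive recursion, and the oracle contains the table. *)
Lemma dec_table (N : nat -> nat) (q : nat -> nat -> nat) (table : nat -> seq bool -> Prop) :
  on_cone (fun Z => forall m S, computable_set (jumps m Z) S ->
    computable_set (jumps m Z) [set x | table x (answers S q x (N x))]).
Proof.
apply: (on_cone_fun (f := N)).
apply: (on_cone_fun (f := fun x => q (cfst x) (csnd x))).
apply: (on_cone_fun (f := fun x => nat_of_bool
   `[<table (cfst x) (rev [seq i == 1 | i <- dseq (csnd x)])>])).
apply: (on_cone_fun (f := succn)).
apply: on_coneT => Z cs ct cq cN m S /computable_setP cS.
have {}cs := cfun_jumps m cs; have {}ct := cfun_jumps m ct.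
have {}cq := cfun_jumps m cq; have {}cN := cfun_jumps m cN.
set Y := jumps m Z in cs ct cq cN cS *.
pose F x k := cseq (rev [seq nat_of_bool b | b <- answers S q x k]).
have cF : cfun Y (fun x => F (cfst x) (csnd x)).
  apply: (@cfun_prec _ (fun=> 0)
    (fun y => (cpair (nat_of_bool `[<S (q (cfst y) (cfst (csnd y)))>])
                     (csnd (csnd y))).+1)) => //.
  - exact: cfun_const.
  - apply: cfun_comp cs _; apply: cfun_pair; last by apply: cfun_comp; exact: cfun_snd.
    apply: cfun_ext (cfun_comp cS (cfun_comp cq (cfun_pair (cfun_fst _)
      (cfun_comp (cfun_fst _) (cfun_snd _))))) => x.
    by rewrite !cpairE.
  - move=> a k; rewrite /F /answers -addn1 iotaD !map_cat rev_cat /= !cpairE.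
    by rewrite add0n.
apply/computable_setP; apply: cfun_ext (cfun_comp ct (cfun_pair (cfun_id _)
   (cfun_comp cF (cfun_pair (cfun_id _) cN)))) => x /=.
rewrite !cpairE /F cseqK map_rev revK -map_comp.
by rewrite (eq_map (g := id)) ?map_id //; case.
Qed.

(** * Ordinals *)

Lemma ole_refl a : ole a a.
Proof. by elim: a => T f IH /= i; exists i. Qed.

Lemma ole_trans b a c : ole a b -> ole b c -> ole a c.
Proof.
elim: b a c => U g IH [T f] [V h] /= ab bc i.
by have [j le] := ab i; have [k le'] := bc j; exists k; apply: IH le le'.
Qed.

Lemma olt_sup U (g : U -> ord) a : olt a (Osup g) <-> exists j, ole a (g j).
Proof. by split=> [/(_ tt)|h []]. Qed.

Lemma ole_sup U (g : U -> ord) b : ole (Osup g) b <-> forall j, olt (g j) b.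
Proof.
by case: b => V h; split=> [le j|le j]; [apply/olt_sup/le|apply/olt_sup/le].
Qed.

Lemma olt_ole_trans b a c : olt a b -> ole b c -> olt a c.
Proof. exact: ole_trans. Qed.

Lemma olt_succ a b : olt a (osucc b) <-> ole a b.
Proof.
by split=> [/olt_sup[]|h] //; apply/olt_sup; exists tt.
Qed.

Lemma ole_olt_total a b : ole a b \/ olt b a.
Proof.
elim: a b => T f IH b; case: (pselect (ole (Osup f) b)) => [|nab]; [by left|right].
apply/olt_sup; apply: contrapT => nex; apply: nab; apply/ole_sup => i.
case: b nex => U g nex; apply/olt_sup; apply: contrapT => nu; apply: nex; exists i.
apply/ole_sup => u; have [h|//] := IH i (g u); by case: nu; exists u.
Qed.

Lemma olt_wf : well_founded olt.
Proof.
move=> a; suff : forall b, ole b a -> Acc olt b by apply; apply: ole_refl.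
elim: a => T f IH b ba; constructor=> c cb.
by have /olt_sup[i /IH] := olt_ole_trans cb ba.
Qed.

Lemma olt_irr a : ~ olt a a.
Proof. by elim/(well_founded_ind olt_wf): a => a IH h; apply: IH (h) (h). Qed.

Lemma olt_le a b : olt a b -> ole a b.
Proof.
elim: a b => T f IH [U g] /olt_sup[j le]; apply/ole_sup => i.
apply/olt_sup; exists j; apply: IH; apply: olt_ole_trans le.
by apply/olt_sup; exists i; apply: ole_refl.
Qed.

Lemma ole1P a : ole (ofin 1) a <-> ~ ole a ozero.
Proof.
split=> [h /(olt_ole_trans h)/olt_irr//|].
by case: (ole_olt_total a ozero).
Qed.

Lemma ole0 a : ole ozero a.
Proof. by case: a => T f []. Qed.

Lemma ole_ofin1 n : 0 < n -> ole (ofin 1) (ofin n).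
Proof. case: n => // n _. exact: (proj2 (olt_succ ozero (ofin n)) (ole0 _)). Qed.

(** * Definable relations *)

(** Relations are treated uniformly over all structures, so that closure
properties of the formula classes need no operation on syntax. *)
Definition query (L : language) (k : nat) := forall M : structure L, k.-tuple M -> Prop.

Definition defines L k (phi : formula L k) (R : query L k) : Prop :=
  forall (M : structure L) (e : k.-tuple M), sat phi e <-> R M e.

Definition Qf L k (R : query L k) : Prop :=
  exists phi : formula L k, finitary_qf phi /\ defines phi R.
Definition Sig L (alpha : ord) k (R : query L k) : Prop :=
  exists phi : formula L k, Sigma_in alpha phi /\ defines phi R.
Definition Pi L (alpha : ord) k (R : query L k) : Prop :=
  exists phi : formula L k, Pi_in alpha phi /\ defines phi R.

Definition same_query L k (R S : query L k) : Prop :=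
  forall (M : structure L) (e : k.-tuple M), R M e <-> S M e.

Definition qcat L k n (P : query L (k + n)) (M : structure L) (e : n.-tuple M)
  (y : k.-tuple M) : Prop := P M (cat_tuple y e).

Lemma cat0_tuple (T : Type) n (y : 0.-tuple T) (e : n.-tuple T) : cat_tuple y e = e.
Proof. by apply: val_inj; rewrite /= tuple0. Qed.

Lemma cat_thead (T : Type) k n (y : k.+1.-tuple T) (e : n.-tuple T) :
  cat_tuple y e = cons_tuple (thead y) (cat_tuple (behead_tuple y) e).
Proof. by apply: val_inj; rewrite /= {1}(tuple_eta y). Qed.

Lemma cat_cons_tuple (T : Type) k n a (y : k.-tuple T) (e : n.-tuple T) :
  cat_tuple (cons_tuple a y) e = cons_tuple a (cat_tuple y e).
Proof. exact: val_inj. Qed.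

Lemma sat_fExs L k n (psi : formula L (k + n)) (M : structure L) (e : n.-tuple M) :
  sat (fExs psi) e <-> exists y : k.-tuple M, sat psi (cat_tuple y e).
Proof.
elim: k psi => [|k IH] psi /=.
  by split=> [h|[y]]; [exists [tuple]|]; rewrite cat0_tuple.
rewrite IH /=; split=> [[y [a h]]|[y]].
  by exists (cons_tuple a y); rewrite cat_cons_tuple.
by rewrite cat_thead => h; exists (behead_tuple y), (thead y).
Qed.

Lemma sat_fAlls L k n (psi : formula L (k + n)) (M : structure L) (e : n.-tuple M) :
  sat (fAlls psi) e <-> forall y : k.-tuple M, sat psi (cat_tuple y e).
Proof.
elim: k psi => [|k IH] psi /=.
  by split=> [h y|/(_ [tuple])]; rewrite cat0_tuple.
rewrite IH /=; split=> [h y|h y a]; last by rewrite -cat_cons_tuple.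
by have := h (behead_tuple y) (thead y); rewrite -cat_thead.
Qed.

Section Classes.
Variable L : language.
Implicit Types alpha beta : ord.

Lemma Qf_ext k (R S : query L k) : same_query R S -> Qf R -> Qf S.
Proof. by move=> e [phi [q d]]; exists phi; split=> // M x; rewrite d. Qed.

Lemma Pi_ext alpha k (R S : query L k) : same_query R S -> Pi alpha R -> Pi alpha S.
Proof. by move=> e [phi [q d]]; exists phi; split=> // M x; rewrite d. Qed.

Lemma Sig_rank0 alpha k (R : query L k) : ole alpha ozero -> Sig alpha R <-> Qf R.
Proof.
move=> a0; split=> [[phi [s d]]|[phi [q d]]]; exists phi; split=> //.
  by case: s a0 {d} => // beta n J K b psi b1 _ /(proj1 (ole1P _) b1).
exact: Sigma_qf.
Qed.

Lemma Pi_rank0 alpha k (R : query L k) : ole alpha ozero -> Pi alpha R <-> Qf R.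
Proof.
move=> a0; split=> [[phi [s d]]|[phi [q d]]]; exists phi; split=> //.
  by case: s a0 {d} => // beta n J K b psi b1 _ /(proj1 (ole1P _) b1).
exact: Pi_qf.
Qed.

Definition qtrue k : query L k := fun _ _ => True.

Lemma Qf_true k : Qf (@qtrue k).
Proof.
exists (fConj set0 (fun=> fAll (fEq L ord0 ord0))); split; last by move=> M e; split.
by constructor=> //; apply: finite_set0.
Qed.

Lemma Qf_not k (R : query L k) : Qf R -> Qf (fun M e => ~ R M e).
Proof.
by move=> [phi [q d]]; exists (fNot phi); split=> [|M e /=]; [constructor|rewrite d].
Qed.

(** The formulas outside J are arbitrary, as in the conjunctions and disjunctions
of [formula]. *)
Lemma choose_formulas (J : set nat) (k : nat -> nat) (R : forall j, query L (k j))
    (C : forall n, nat -> formula L n -> Prop) :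
  (forall j, J j -> exists phi : formula L (k j), C _ j phi /\ defines phi (R j)) ->
  exists psi : forall j, formula L (k j),
    forall j, J j -> C _ j (psi j) /\ defines (psi j) (R j).
Proof.
move=> h.
have h' j : exists phi : formula L (k j), J j -> C _ j phi /\ defines phi (R j).
  case: (pselect (J j)) => [/h[phi p]|nJ]; first by exists phi.
  by have [phi _] := Qf_true (k j); exists phi.
by exists (fun j => projT1 (cid (h' j))) => j Jj; apply: projT2 (cid (h' j)) Jj.
Qed.

Lemma Qf_forall_ord m k (R : 'I_m -> query L k) :
  (forall i, Qf (R i)) -> Qf (fun M e => forall i, R i M e).
Proof.
move=> h.
have [j|psi psiP] := @choose_formulas `I_m (fun=> k)
  (fun j M e => forall i : 'I_m, i = j :> nat -> R i M e) (fun n _ phi => finitary_qf phi).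
  move=> lt; have [phi [q d]] := h (Ordinal lt).
  exists phi; split=> // M e; rewrite d; split=> [r i ei|]; last by apply.
  by have -> : i = Ordinal lt by apply: val_inj.
exists (fConj `I_m psi); split=> [|M e /=].
  by constructor=> [|j /psiP[]//]; apply: finite_II.
split=> [s i|r j /psiP[_ ->] i _]; last exact: r.
by have [_ d] := psiP i (ltn_ord i); apply: (proj1 (d _ _) (s i (ltn_ord i))).
Qed.

Lemma Qf_and k (R S : query L k) : Qf R -> Qf S -> Qf (fun M e => R M e /\ S M e).
Proof.
move=> qR qS.
have : Qf (fun M e => forall i : 'I_2, (if i == ord0 then R else S) M e).
  by apply: Qf_forall_ord => i; case: ifP.
apply: Qf_ext => M e; split=> [h|[r s] i]; last by case: ifP.
by split; [have := h ord0|have := h ord_max].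
Qed.

(** This lemma, [PiI], [SigE] and [PiE] replace formulas of positive rank by the
disjunctions and conjunctions of relations that they stand for; closure
properties are proved by induction on rank through these four. *)
Lemma SigI alpha n (J : set nat) (k : nat -> nat) (P : forall j, query L (k j + n))
    (R : query L n) :
  ole (ofin 1) alpha ->
  (forall j, J j -> exists beta, olt beta alpha /\ Pi beta (P j)) ->
  (forall M e, R M e <-> exists j, J j /\ exists y, qcat (P j) e y) -> Sig alpha R.
Proof.
move=> a1 hP hR.
have [j Jj|psi psiP] := @choose_formulas J (fun j => k j + n) P
    (fun n _ phi => exists beta, olt beta alpha /\ Pi_in beta phi).
  by have [b [lt [phi [p d]]]] := hP j Jj; exists phi; split=> //; exists b.
have hb j : exists beta, J j -> olt beta alpha /\ Pi_in beta (psi j).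
  case: (pselect (J j)) => [/psiP[[b h] _]|nJ]; first by exists b.
  by exists ozero.
have [b bP] := choice hb.
exists (fDisj J (fun j => fExs (psi j))); split; first by apply: (Sigma_disj (beta := b)).
move=> M e; rewrite hR /=; split=> -[j [Jj h]]; exists j; split=> //.
  by have /sat_fExs[y s] := h; exists y; apply/(proj2 (psiP j Jj)).
by have [y s] := h; apply/sat_fExs; exists y; apply/(proj2 (psiP j Jj)).
Qed.

Lemma PiI alpha n (J : set nat) (k : nat -> nat) (P : forall j, query L (k j + n))
    (R : query L n) :
  ole (ofin 1) alpha ->
  (forall j, J j -> exists beta, olt beta alpha /\ Sig beta (P j)) ->
  (forall M e, R M e <-> forall j, J j -> forall y, qcat (P j) e y) -> Pi alpha R.
Proof.
move=> a1 hP hR.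
have [j Jj|psi psiP] := @choose_formulas J (fun j => k j + n) P
    (fun n _ phi => exists beta, olt beta alpha /\ Sigma_in beta phi).
  by have [b [lt [phi [p d]]]] := hP j Jj; exists phi; split=> //; exists b.
have hb j : exists beta, J j -> olt beta alpha /\ Sigma_in beta (psi j).
  case: (pselect (J j)) => [/psiP[[b h] _]|nJ]; first by exists b.
  by exists ozero.
have [b bP] := choice hb.
exists (fConj J (fun j => fAlls (psi j))); split; first by apply: (Pi_conj (beta := b)).
move=> M e; rewrite hR /=; split=> h j Jj.
  by move=> y; apply/(proj2 (psiP j Jj)); have /sat_fAlls := h j Jj; apply.
by apply/sat_fAlls => y; apply/(proj2 (psiP j Jj)); apply: h.
Qed.

Lemma SigE alpha n (R : query L n) : Sig alpha R -> ole (ofin 1) alpha ->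
  exists (J : set nat) (k : nat -> nat) (P : forall j, query L (k j + n)),
    (forall j, J j -> exists beta, olt beta alpha /\ Pi beta (P j)) /\
    (forall M e, R M e <-> exists j, J j /\ exists y, qcat (P j) e y).
Proof.
case=> phi [s]; case: s R => {alpha n phi} alpha n.
  by move=> phi a0 _ R _ /ole1P.
move=> J k b psi _ hpsi R d _; exists J, k, (fun j M e => sat (psi j) e); split.
  by move=> j /hpsi[lt p]; exists (b j); split=> //; exists (psi j).
by move=> M e; rewrite -d /=; split=> -[j [Jj /sat_fExs h]]; exists j.
Qed.

Lemma PiE alpha n (R : query L n) : Pi alpha R -> ole (ofin 1) alpha ->
  exists (J : set nat) (k : nat -> nat) (P : forall j, query L (k j + n)),
    (forall j, J j -> exists beta, olt beta alpha /\ Sig beta (P j)) /\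
    (forall M e, R M e <-> forall j, J j -> forall y, qcat (P j) e y).
Proof.
case=> phi [s]; case: s R => {alpha n phi} alpha n.
  by move=> phi a0 _ R _ /ole1P.
move=> J k b psi _ hpsi R d _; exists J, k, (fun j M e => sat (psi j) e); split.
  by move=> j /hpsi[lt p]; exists (b j); split=> //; exists (psi j).
by move=> M e; rewrite -d /=; split=> h j /h /sat_fAlls.
Qed.

(** De Morgan's laws, by simultaneous induction on rank. *)
Lemma Sig_not_Pi alpha : forall k (R : query L k),
  (Sig alpha R -> Pi alpha (fun M e => ~ R M e)) /\
  (Pi alpha R -> Sig alpha (fun M e => ~ R M e)).
Proof.
elim/(well_founded_ind olt_wf): alpha => alpha IH k R.
case: (pselect (ole alpha ozero)) => [a0|/ole1P a1].
  rewrite !Sig_rank0 // !Pi_rank0 //; split; exact: Qf_not.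
split=> h.
  have [J [m [P [hP hR]]]] := SigE h a1.
  apply: (PiI (J := J) (k := m) (P := fun j M e => ~ P j M e) a1).
    by move=> j /hP[b [lt p]]; exists b; split=> //; have [_] := IH b lt _ (P j); apply.
  move=> M e; rewrite hR; split=> [nR j Jj y p|h' [j [Jj [y p]]]].
    by apply: nR; exists j; split=> //; exists y.
  exact: h' p.
have [J [m [P [hP hR]]]] := PiE h a1.
apply: (SigI (J := J) (k := m) (P := fun j M e => ~ P j M e) a1).
  by move=> j /hP[b [lt p]]; exists b; split=> //; have [] := IH b lt _ (P j); move=> +_; apply.
move=> M e; rewrite hR; split=> [nR|[j [Jj [y np]]] h']; last exact: np (h' _ Jj _).
apply: contrapT => nex; apply: nR => j Jj y; apply: contrapT => np.
by apply: nex; exists j; split=> //; exists y.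
Qed.

Lemma Sig_not alpha k (R : query L k) : Sig alpha R -> Pi alpha (fun M e => ~ R M e).
Proof. by have [] := Sig_not_Pi alpha R. Qed.

Lemma Pi_not alpha k (R : query L k) : Pi alpha R -> Sig alpha (fun M e => ~ R M e).
Proof. by have [] := Sig_not_Pi alpha R. Qed.

Lemma Sig_of_lt beta alpha k (R : query L k) : olt beta alpha -> Pi beta R -> Sig alpha R.
Proof.
move=> lt p; apply: (@SigI _ _ [set 0] (fun=> 0) (fun=> R)).
- case: (ole_olt_total (ofin 1) alpha) => // /olt_succ a0.
  by have := olt_ole_trans lt a0; move=> /olt_sup[[]].
- by move=> j _; exists beta.
- move=> M e; split=> [r|[j [_ [y]]]]; last by rewrite /qcat cat0_tuple.
  by exists 0; split=> //; exists [tuple]; rewrite /qcat cat0_tuple.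
Qed.

Lemma olt_ge1 (alpha beta : ord) : olt beta alpha -> ole (ofin 1) alpha.
Proof.
move=> lt; case: (ole_olt_total (ofin 1) alpha) => // /olt_succ a0.
by have /olt_sup[[]] := olt_ole_trans lt a0.
Qed.

Lemma Pi_of_lt beta alpha k (R : query L k) : olt beta alpha -> Sig beta R -> Pi alpha R.
Proof.
move=> lt /Sig_not /(Sig_of_lt lt) /Sig_not; apply: Pi_ext => M e.
by split=> [/contrapT|r nr].
Qed.

Lemma Sig_mono beta alpha k (R : query L k) : ole beta alpha -> Sig beta R -> Sig alpha R.
Proof.
move=> le s; case: (pselect (ole beta ozero)) => [b0|/ole1P b1]; last first.
  have [J [m [P [hP hR]]]] := SigE s b1.
  apply: (SigI (J := J) (k := m) (P := P)) => //; first exact: ole_trans le.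
  by move=> j /hP[b [lt p]]; exists b; split=> //; apply: olt_ole_trans lt le.
have q := proj1 (Sig_rank0 R b0) s.
case: (pselect (ole alpha ozero)) => [a0|/ole1P a1]; first exact/Sig_rank0.
by apply: (Sig_of_lt (beta := ozero)) => //; apply/Pi_rank0 => //; apply: ole_refl.
Qed.

Lemma Pi_mono beta alpha k (R : query L k) : ole beta alpha -> Pi beta R -> Pi alpha R.
Proof.
move=> le /Pi_not /(Sig_mono le) /Sig_not; apply: Pi_ext => M e.
by split=> [/contrapT|r nr].
Qed.

(** Semantically, the substitution of the variable [rho i] for the variable i. *)
Definition pull (T : Type) n m (rho : 'I_n -> 'I_m) (e : m.-tuple T) : n.-tuple T :=
  [tuple tnth e (rho i) | i < n].

Lemma tnth_pull (T : Type) n m (rho : 'I_n -> 'I_m) (e : m.-tuple T) i :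
  tnth (pull rho e) i = tnth e (rho i).
Proof. exact: tnth_mktuple. Qed.

Lemma val_pull_cast (T : Type) n m (eq_nm : n = m) (e : m.-tuple T) :
  pull (cast_ord eq_nm) e = e :> seq T.
Proof.
case: m / eq_nm e => e; congr val; apply: eq_from_tnth => i.
by rewrite tnth_pull cast_ord_id.
Qed.

Lemma Qf_pull n m (rho : 'I_n -> 'I_m) (R : query L n) :
  Qf R -> Qf (fun M e => R M (pull rho e)).
Proof.
case=> phi [q d].
suff : Qf (fun (M : structure L) (e : m.-tuple M) => sat phi (pull rho e)).
  by apply: Qf_ext => M e; apply: d.
elim: q rho => {n phi R d} n.
- move=> s v rho; exists (fRel (map_tuple rho v)); split; first by constructor.
  move=> M e /=; suff -> : map_tuple (tnth e) (map_tuple rho v) =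
    map_tuple (tnth (pull rho e)) v by [].
  by apply: eq_from_tnth => i; rewrite 3!tnth_map tnth_pull.
- move=> i j rho; exists (fEq L (rho i) (rho j)); split; first by constructor.
  by move=> M e /=; rewrite !tnth_pull.
- by move=> phi _ IH rho; apply: Qf_not.
- move=> J phi fJ _ IH rho.
  have [j|psi psiP] := @choose_formulas J (fun=> m)
    (fun j M e => sat (phi j) (pull rho e)) (fun n _ phi => finitary_qf phi).
    by move=> Jj; apply: (IH j Jj rho).
  exists (fConj J psi); split=> [|M e /=]; first by constructor=> // j /psiP[].
  by split=> h j Jj; apply/(proj2 (psiP j Jj)); apply: h.
- move=> J phi fJ _ IH rho.
  have [j|psi psiP] := @choose_formulas J (fun=> m)
    (fun j M e => sat (phi j) (pull rho e)) (fun n _ phi => finitary_qf phi).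
    by move=> Jj; apply: (IH j Jj rho).
  exists (fDisj J psi); split=> [|M e /=]; first by constructor=> // j /psiP[].
  by split=> -[j [Jj h]]; exists j; split=> //; apply/(proj2 (psiP j Jj)).
Qed.

Definition ord_lift k n m (rho : 'I_n -> 'I_m) (i : 'I_(k + n)) : 'I_(k + m) :=
  match fintype.split i with inl j => lshift m j | inr j => rshift k (rho j) end.

Lemma pull_ord_lift (T : Type) k n m (rho : 'I_n -> 'I_m) (y : k.-tuple T) e :
  pull (ord_lift rho) (cat_tuple y e) = cat_tuple y (pull rho e).
Proof.
apply: eq_from_tnth => i; rewrite tnth_pull /ord_lift.
case: (split_ordP i) => j ->; first by rewrite !tnth_lshift.
by rewrite !tnth_rshift tnth_pull.
Qed.

Lemma Sig_Pi_pull alpha : forall n m (rho : 'I_n -> 'I_m) (R : query L n),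
  (Sig alpha R -> Sig alpha (fun M e => R M (pull rho e))) /\
  (Pi alpha R -> Pi alpha (fun M e => R M (pull rho e))).
Proof.
elim/(well_founded_ind olt_wf): alpha => alpha IH n m rho.
have S (R : query L n) : Sig alpha R -> Sig alpha (fun M e => R M (pull rho e)).
  case: (pselect (ole alpha ozero)) => [a0|/ole1P a1] s.
    by move/Sig_rank0 : s => /(_ a0) q; apply/Sig_rank0 => //; apply: Qf_pull q.
  have [J [k [P [hP hR]]]] := SigE s a1.
  apply: (SigI (J := J) (k := k) (P := fun j M e => P j M (pull (ord_lift rho) e))) => //.
    move=> j /hP[b [lt p]]; exists b; split=> //.
    by have [_] := IH b lt _ _ (ord_lift rho) (P j); apply.
  move=> M e; rewrite hR.
  split=> -[j [Jj [y p]]]; exists j; split=> //; exists y; move: p;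
    by rewrite /qcat pull_ord_lift.
move=> R; split; first exact: S.
move=> /Pi_not /S /Sig_not; apply: Pi_ext => M e.
by split=> [/contrapT|r nr].
Qed.

Lemma Pi_pull alpha n m (rho : 'I_n -> 'I_m) (R : query L n) :
  Pi alpha R -> Pi alpha (fun M e => R M (pull rho e)).
Proof. by have [] := Sig_Pi_pull alpha rho R. Qed.

(** The conjuncts of all the R i are conjuncts of a single formula, indexed by
pairs. *)
Lemma Pi_forall_nat alpha k (R : nat -> query L k) : ole (ofin 1) alpha ->
  (forall i, Pi alpha (R i)) -> Pi alpha (fun M e => forall i, R i M e).
Proof.
move=> a1 hR.
have h i : exists X : set nat * {m : nat -> nat & forall j, query L (m j + k)},
    (forall j, X.1 j -> exists beta, olt beta alpha /\ Sig beta (tagged X.2 j)) /\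
    (forall M e, R i M e <-> forall j, X.1 j -> forall y, qcat (tagged X.2 j) e y).
  have [J [m [P PP]]] := PiE (hR i) a1.
  by exists (J, existT _ m P).
have [X XP] := choice h.
apply: (@PiI _ _ [set z | (X (cfst z)).1 (csnd z)] (fun z => tag (X (cfst z)).2 (csnd z))
   (fun z => tagged (X (cfst z)).2 (csnd z))) => //.
  by move=> z; apply: (proj1 (XP _)).
move=> M e; split=> [r z Xz y|r i]; first exact: (proj1 (proj2 (XP _) M e)).
apply/(proj2 (XP i)) => j Xj y.
by have := r (cpair i j); rewrite /= !cpairE; apply.
Qed.

Lemma Pi_and alpha k (R S : query L k) :
  Pi alpha R -> Pi alpha S -> Pi alpha (fun M e => R M e /\ S M e).
Proof.
case: (pselect (ole alpha ozero)) => [a0|/ole1P a1].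
  by rewrite !Pi_rank0 //; apply: Qf_and.
move=> pR pS; have : Pi alpha (fun M e => forall i, (if i == 0 then R else S) M e).
  by apply: Pi_forall_nat => // i; case: ifP.
apply: Pi_ext => M e; split=> [h|[r s] i]; last by case: ifP.
by split; [have := h 0|have := h 1].
Qed.

(** The new block of quantifiers merges with the block of each disjunct. The two
blocks bind [m j] and k variables, hence the reassociation by [cast_ord]. *)
Lemma Sig_ex alpha k n (R : query L (k + n)) : ole (ofin 1) alpha -> Sig alpha R ->
  Sig alpha (fun M e => exists y, qcat R e y).
Proof.
move=> a1 s; have [J [m [P [hP hR]]]] := SigE s a1.
apply: (@SigI _ _ J (fun j => m j + k)
  (fun j M e => P j M (pull (cast_ord (addnA (m j) k n)) e))) => //.
  by move=> j /hP[b [lt p]]; exists b; split=> //; apply: Pi_pull.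
have assoc j (M : structure L) (z : (m j).-tuple M) (y : k.-tuple M) (e : n.-tuple M) :
    pull (cast_ord (addnA (m j) k n)) (cat_tuple (cat_tuple z y) e) =
    cat_tuple z (cat_tuple y e).
  by apply: val_inj; rewrite [LHS]val_pull_cast /= catA.
move=> M e; split=> [[y]|[j [Jj [zy p]]]].
  rewrite /qcat hR => -[j [Jj [z p]]]; exists j; split=> //; exists (cat_tuple z y).
  by rewrite assoc.
pose z := [tuple tnth zy (lshift k i) | i < m j].
pose y := [tuple tnth zy (rshift (m j) i) | i < k].
exists y; rewrite /qcat hR; exists j; split=> //; exists z.
rewrite /qcat -assoc; suff -> : cat_tuple z y = zy by [].
apply: eq_from_tnth => i; case: (split_ordP i) => l ->.
  by rewrite tnth_lshift tnth_mktuple.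
by rewrite tnth_rshift tnth_mktuple.
Qed.

End Classes.

(** * Isomorphisms *)

Section Isomorphisms.
Variable L : language.
Implicit Types A B C : structure L.

Lemma map_tuple_comp (T U V : Type) (f : U -> V) (g : T -> U) k (t : k.-tuple T) :
  map_tuple f (map_tuple g t) = map_tuple (f \o g) t.
Proof. by apply: eq_from_tnth => i; rewrite !tnth_map. Qed.

Lemma map_tuple_id_in (T : Type) (f : T -> T) k (t : k.-tuple T) :
  (forall x, f x = x) -> map_tuple f t = t.
Proof. by move=> h; apply: eq_from_tnth => i; rewrite tnth_map. Qed.

Lemma iso_id A : is_isomorphism (@id A).
Proof. by split=> [|s t]; [exists id|rewrite map_tuple_id_in]. Qed.

Lemma iso_comp A B C (f : A -> B) (g : B -> C) :
  is_isomorphism f -> is_isomorphism g -> is_isomorphism (g \o f).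
Proof.
move=> [bf hf] [bg hg]; split; first exact: bij_comp.
by move=> s t; rewrite hf hg map_tuple_comp.
Qed.

Lemma iso_inv A B (f : A -> B) : is_isomorphism f ->
  exists2 g : B -> A, is_isomorphism g & cancel f g /\ cancel g f.
Proof.
move=> [[g fK gK] hf]; exists g => //; split; first by exists f.
by move=> s t; rewrite hf map_tuple_comp map_tuple_id_in.
Qed.

Lemma sat_iso A B (f : A -> B) n (phi : formula L n) (e : n.-tuple A) :
  is_isomorphism f -> sat phi e <-> sat phi (map_tuple f e).
Proof.
move=> [bf hf]; have fI := bij_inj bf.
have consf n0 a (e0 : n0.-tuple A) :
    cons_tuple (f a) (map_tuple f e0) = map_tuple f (cons_tuple a e0).
  exact: val_inj.
elim: phi e => {n} [n s v|n i j|n phi IH|n J phi IH|n J phi IH|n phi IH|n phi IH] e /=.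
- rewrite hf map_tuple_comp.
  suff -> : map_tuple (f \o tnth e) v = map_tuple (tnth (map_tuple f e)) v by [].
  by apply: eq_from_tnth => i; rewrite 3!tnth_map.
- by rewrite !tnth_map; split=> [->|/fI].
- by rewrite IH.
- by split=> h j Jj; apply/IH; apply: h.
- by split=> -[j [Jj h]]; exists j; split=> //; apply/IH.
- split=> h a; last by apply/IH; rewrite -consf; apply: h.
  have [g fK gK] := bf; rewrite -(gK a) consf; apply/IH; exact: h.
- split=> -[a h]; first by exists (f a); rewrite consf; apply/IH.
  have [g fK gK] := bf; exists (g a); apply/IH; rewrite -consf gK; exact: h.
Qed.

Lemma query_iso A B (f : A -> B) n (R : query L n) (e : n.-tuple A) :
  (exists phi, defines phi R) ->
  is_isomorphism f -> R A e <-> R B (map_tuple f e).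
Proof. by move=> [phi d] iso; rewrite -!d; apply: sat_iso. Qed.

(** The even and odd steps of a back-and-forth construction appear here as
[eB] and [eC], the stages at which a given element is treated. *)
Lemma iso_of_pairs B C (p : nat -> B * C) (eB : B -> nat) (eC : C -> nat) :
  (forall b, (p (eB b)).1 = b) -> (forall c, (p (eC c)).2 = c) ->
  (forall i j, (p i).1 = (p j).1 <-> (p i).2 = (p j).2) ->
  (forall s (v : (arity s).-tuple nat),
     rel_of (map_tuple (fst \o p) v) <-> rel_of (map_tuple (snd \o p) v)) ->
  let f b := (p (eB b)).2 in
  is_isomorphism f /\ forall i, f (p i).1 = (p i).2.
Proof.
move=> hB hC heq hrel f.
have fp i : f (p i).1 = (p i).2 by apply/heq; rewrite hB.
split=> //; split.
  exists (fun c => (p (eC c)).1) => [b|c]; last by rewrite fp.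
  by rewrite -[RHS]hB; apply/heq; rewrite hC.
move=> s t; have := hrel s (map_tuple eB t); rewrite !map_tuple_comp.
by rewrite map_tuple_id_in.
Qed.

End Isomorphisms.

(** * Back and forth *)

(** Most recent element first, so that a step of a construction is a cons. *)
Fixpoint hist (T : Type) (u : nat -> T) (t : nat) : seq T :=
  if t is t'.+1 then u t' :: hist u t' else [::].

Lemma size_hist T (u : nat -> T) t : size (hist u t) = t.
Proof. by elim: t => //= t ->. Qed.

Lemma In_hist T (u : nat -> T) i t : i < t -> List.In (u i) (hist u t).
Proof.
elim: t => // t IH; rewrite ltnS leq_eqVlt => /orP[/eqP->|/IH]; first by left.
by right.
Qed.

Lemma In_catl T (x : T) s s' : List.In x s -> List.In x (s ++ s').
Proof. by elim: s => //= y s IH [->|/IH]; [left|right]. Qed.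

Lemma In_catr T (x : T) s s' : List.In x s' -> List.In x (s ++ s').
Proof. by elim: s => //= y s IH /IH; right. Qed.

Lemma In_tnth T k (z : k.-tuple T) i : List.In (tnth z i) z.
Proof.
rewrite (tnth_nth (tnth z i)); have : i < size z by rewrite size_tuple.
move: (tnth z i) (val i) (val z) => x; move=> m s; elim: s m => //= y s IH [|m].
  by left.
by rewrite ltnS => /IH; right.
Qed.

(** Dependent choice in which a step sees the whole past. *)
Lemma choose_seq T (E : seq T -> Prop) (Q : seq T -> T -> Prop) : E [::] ->
  (forall s, E s -> exists x, E (x :: s) /\ Q s x) ->
  exists u : nat -> T, forall t, E (hist u t) /\ Q (hist u t) (u t).
Proof.
move=> E0 step.
pose nx (s : {s | E s}) := cid (step (projT1 s) (projT2 s)).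
pose st := fix st t : {s | E s} := if t is t'.+1
  then exist E (projT1 (nx (st t')) :: projT1 (st t')) (proj1 (projT2 (nx (st t'))))
  else exist E [::] E0.
pose u t := projT1 (nx (st t)).
have hu t : hist u t = projT1 (st t) by elim: t => //= t ->.
exists u => t; rewrite hu; split; first exact: projT2 (st t).
exact: proj2 (projT2 (nx (st t))).
Qed.

Definition partial_iso L (B C : structure L) (s : seq (B * C)) : Prop :=
  (forall p q, List.In p s -> List.In q s -> p.1 = q.1 <-> p.2 = q.2) /\
  (forall r (w : (arity r).-tuple (B * C)), (forall i, List.In (tnth w i) s) ->
     rel_of (map_tuple fst w) <-> rel_of (map_tuple snd w)).

Lemma iso_of_partial L (B C : structure L) (p : nat -> B * C) eB eC s0 :
  (forall b, (p (eB b)).1 = b) -> (forall c, (p (eC c)).2 = c) ->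
  (forall t, partial_iso (hist p t ++ s0)) ->
  let f b := (p (eB b)).2 in
  is_isomorphism f /\ forall q, List.In q s0 -> f q.1 = q.2.
Proof.
move=> hB hC part.
have inp i t : i < t -> List.In (p i) (hist p t ++ s0).
  by move=> lt; apply: In_catl; apply: In_hist.
have [//|//|i j|r v|iso fp] := @iso_of_pairs _ B C p eB eC.
- have [heq _] := part (maxn i j).+1.
  by apply: heq; apply: inp; rewrite ltnS ?leq_maxl ?leq_maxr.
- have [_ hrel] := part (\max_(i <- v) i).+1.
  have := hrel r (map_tuple p v); rewrite !map_tuple_comp; apply=> i.
  by rewrite tnth_map; apply: inp; rewrite ltnS; apply: leq_bigmax_seq => //; apply: mem_tnth.
split=> // q qs; have [heq _] := part (eB q.1).+1.
apply/heq; [exact: inp|exact: In_catr|exact: hB].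
Qed.

(** For a symmetric relation between tuples of one structure, going back is going
forth with the tuples exchanged. *)
Section SymmetricForth.
Variables (L : language) (A : structure L) (eA : A -> nat).
Hypothesis eA_inj : injective eA.
Variable E : forall k, k.-tuple A -> k.-tuple A -> Prop.
Hypothesis E_sym : forall k (a b : k.-tuple A), E a b -> E b a.
Hypothesis E_forth : forall k (a b : k.-tuple A), E a b ->
  forall c, exists d, E (cons_tuple c a) (cons_tuple d b).
Hypothesis E_qf : forall k (a b : k.-tuple A), E a b ->
  forall R : query L k, Qf R -> R A a -> R A b.

Let E' (s : seq (A * A)) :=
  E (map_tuple fst (in_tuple s)) (map_tuple snd (in_tuple s)).

Lemma E_partial_iso s : E' s -> partial_iso s.
Proof.
move=> h; have hq (R : query L (size s)) (qR : Qf R) :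
    R A (map_tuple fst (in_tuple s)) <-> R A (map_tuple snd (in_tuple s)).
  by split; apply: E_qf qR => //; apply: E_sym.
have idx p : List.In p s -> exists i, tnth (in_tuple s) i = p.
  move=> ps; have : exists2 i, i < size s & nth p s i = p.
    elim: (s) ps => //= q s' IH [->|/IH[i lt e]]; first by exists 0.
    by exists i.+1.
  by move=> [i lt e]; exists (Ordinal lt); rewrite (tnth_nth p).
split=> [p q /idx[i <-] /idx[j <-]|r w hw].
  have := hq (fun M e => tnth e i = tnth e j); rewrite !tnth_map; apply.
  by exists (fEq L i j); split=> //; constructor.
have [l hl] := choice (fun i => idx _ (hw i)).
have qr : Qf (fun (M : structure L) e => rel_of (map_tuple (tnth e) (mktuple l))).
  by exists (fRel (mktuple l)); split=> //; constructor.
move: (hq _ qr); suff eq (f : A * A -> A) :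
    map_tuple (tnth (map_tuple f (in_tuple s))) (mktuple l) = map_tuple f w.
  by rewrite !eq.
by apply: eq_from_tnth => i; rewrite 2!tnth_map tnth_mktuple tnth_map hl.
Qed.

Lemma E_tuple k (z : k.-tuple (A * A)) :
  E (map_tuple fst z) (map_tuple snd z) -> E' z.
Proof.
case: z => s sz; have e := eqP sz; case: k / e sz => sz h.
by congr E: h; apply: val_inj.
Qed.

Lemma orbit_of_symmetric_forth k (a b : k.-tuple A) : E a b -> orbit_of a b.
Proof.
move=> Eab; case: (pselect (inhabited A)) => [[x0]|nA]; last first.
  exists id; split; first exact: iso_id.
  by apply: eq_from_tnth => i; case: nA; constructor; apply: tnth b i.
pose z := [tuple (tnth a i, tnth b i) | i < k].
have fstz : map_tuple fst z = a.
  by apply: eq_from_tnth => i; rewrite tnth_map tnth_mktuple.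
have sndz : map_tuple snd z = b.
  by apply: eq_from_tnth => i; rewrite tnth_map tnth_mktuple.
have E0 : E' z by apply: E_tuple; rewrite fstz sndz.
have [|s Es|p hp] := @choose_seq (A * A) (fun s => E' (s ++ z))
    (fun s x => forall c, (size s = (eA c).*2 -> x.1 = c) /\
                          (size s = (eA c).*2.+1 -> x.2 = c)).
- exact: E0.
(* Stage 2i puts the element of code i into the domain, stage 2i+1 into the range;
   a stage whose code belongs to no element adds an arbitrary pair. *)
- have [[c e]|nc] := pselect (exists c, size s = (eA c).*2).
    have [d Ed] := E_forth Es c; exists (c, d); split.
      by congr E: Ed; apply: val_inj.
    move=> c'; split=> /=; rewrite e; last by lia.
    by move/double_inj/eA_inj.
  have [[c e]|nc'] := pselect (exists c, size s = (eA c).*2.+1).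
    have [d Ed] := E_forth (E_sym Es) c; exists (d, c); split.
      by congr E: (E_sym Ed); apply: val_inj.
    move=> c'; split=> /=; rewrite e; first by lia.
    by move=> [] /double_inj/eA_inj.
  have [d Ed] := E_forth Es x0; exists (x0, d); split.
    by congr E: Ed; apply: val_inj.
  by move=> c; split=> e; [case: nc|case: nc']; exists c.
have [c|c|t|iso fp] := @iso_of_partial _ A A p (fun c => (eA c).*2)
    (fun c => (eA c).*2.+1) z.
- by have [_ /(_ c)[+ _]] := hp (eA c).*2; rewrite size_hist; apply.
- by have [_ /(_ c)[_ +]] := hp (eA c).*2.+1; rewrite size_hist; apply.
- by have [/E_partial_iso] := hp t.
exists (fun b => (p (eA b).*2).2); split=> //.
apply: eq_from_tnth => i; rewrite tnth_map; symmetry.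
apply: (fp (tnth a i, tnth b i)).
by have := In_tnth z i; rewrite tnth_mktuple.
Qed.

End SymmetricForth.

(** * Existence of the Scott rank *)

Lemma countable_code (T : Type) : countable [set: T] -> exists e : T -> nat, injective e.
Proof.
move=> /countable_injP[e inj]; exists e => x y exy.
by apply: inj; rewrite ?in_setT.
Qed.

Lemma enum_of_code (T : Type) (e : T -> nat) (x0 : T) : injective e ->
  exists u : nat -> T, forall x, exists i, u i = x.
Proof.
move=> inj; have h i : exists x, (exists y, e y = i) -> e x = i.
  by case: (pselect (exists y, e y = i)) => [[y <-]|ny]; [exists y|exists x0].
have [u hu] := choice h; exists u => x; exists (e x).
by apply: inj; apply: hu; exists x.
Qed.

Lemma tuple_code (T : Type) (e : T -> nat) k : injective e ->
  injective (fun a : k.-tuple T => cseq (map e a)).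
Proof. by move=> inj a b /cseq_inj/(inj_map inj)/val_inj. Qed.

Lemma Sigma_definableP L (A : structure L) alpha k (S : set (k.-tuple A)) :
  Sigma_definable alpha S <->
  exists R : query L k, Sig alpha R /\ forall b, S b <-> R A b.
Proof.
split=> [[phi [s ->]]|[R [[phi [s d]] hS]]].
  by exists (fun M e => sat phi e); split=> //; exists phi.
exists phi; split=> //; apply/seteqP; split=> b /=; first by rewrite d -hS.
by rewrite d -hS.
Qed.

Lemma orbits_definable_mono L (A : structure L) alpha beta :
  ole alpha beta -> orbits_definable A alpha -> orbits_definable A beta.
Proof.
move=> le h k a; have /Sigma_definableP[R [s hR]] := h k a.
by apply/Sigma_definableP; exists R; split=> //; apply: Sig_mono s.
Qed.

Section ScottAnalysis.
Variables (L : language) (A : structure L) (eA : A -> nat).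
Hypothesis eA_inj : injective eA.

(** The formulas of all ranks together form a class closed under all operations
of the infinitary logic. *)
Definition inf_query k (R : query L k) := exists alpha, Sig alpha R.

Lemma inf_not k (R : query L k) : inf_query R -> inf_query (fun M e => ~ R M e).
Proof.
move=> [a s]; exists (osucc a); apply: Sig_of_lt (Sig_not s).
by apply/olt_succ; apply: ole_refl.
Qed.

Lemma inf_forall k (R : nat -> query L k) :
  (forall i, inf_query (R i)) -> inf_query (fun M e => forall i, R i M e).
Proof.
move=> /choice[a ha]; exists (osucc (osucc (Osup a))).
apply: (Sig_of_lt (beta := osucc (Osup a))).
  by apply/olt_succ; apply: ole_refl.
apply: Pi_forall_nat => [|i]; first by apply: olt_ge1; apply/olt_succ; apply: ole_refl.
apply: Pi_of_lt (ha i); apply/olt_succ; apply: olt_le; apply/olt_sup.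
by exists i; apply: ole_refl.
Qed.

Lemma inf_exists k (R : query L k.+1) : inf_query R ->
  inf_query (fun M e => exists a, R M (cons_tuple a e)).
Proof.
move=> [a s]; exists (osucc (osucc a)).
apply: (@SigI _ _ _ setT (fun=> 1) (fun=> R)).
- by apply: olt_ge1; apply/olt_succ; apply: ole_refl.
- move=> _ _; exists (osucc a); split; first by apply/olt_succ; apply: ole_refl.
  by apply: Pi_of_lt s; apply/olt_succ; apply: ole_refl.
- move=> M e; split=> [[x r]|[_ [_ [y]]]].
    exists 0; split=> //; exists [tuple x].
    by congr (R M _): r; apply: val_inj.
  by rewrite /qcat cat_thead cat0_tuple => r; exists (thead y).
Qed.

Definition same_inf_type k (a b : k.-tuple A) :=
  forall R : query L k, inf_query R -> R A a -> R A b.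

Lemma not_same_inf_type k (a b : k.-tuple A) : ~ same_inf_type a b ->
  exists R : query L k, [/\ inf_query R, R A a & ~ R A b].
Proof.
move=> h; apply: contrapT => nex; apply: h => R qR ra; apply: contrapT => nb.
by apply: nex; exists R.
Qed.

Lemma same_inf_type_sym k (a b : k.-tuple A) : same_inf_type a b -> same_inf_type b a.
Proof.
move=> h R qR rb; apply: contrapT => nra.
by have := h _ (inf_not qR) nra.
Qed.

(** If no d matched c, there would be for each d a relation true of c and a but
false of d and b. The statement that some element satisfies all of them is
true of a, hence of b, and its witness is one of the d. *)
Lemma same_inf_type_forth k (a b : k.-tuple A) : same_inf_type a b ->
  forall c, exists d, same_inf_type (cons_tuple c a) (cons_tuple d b).
Proof.
move=> h c; apply: contrapT => nd.
have [u hu] := enum_of_code c eA_inj.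
have hR i : exists R : query L k.+1,
    [/\ inf_query R, R A (cons_tuple c a) & ~ R A (cons_tuple (u i) b)].
  by apply: not_same_inf_type => s; apply: nd; exists (u i).
have [R RP] := choice hR.
have [||d hd] := h (fun M e => exists x, forall i, R i M (cons_tuple x e)).
- apply: (@inf_exists k (fun M e => forall i, R i M e)).
  by apply: inf_forall => i; have [] := RP i.
- by exists c => i; have [] := RP i.
- by have [i di] := hu d; have [_ _ nr] := RP i; apply: nr; rewrite di.
Qed.

(** For each tuple u i outside the orbit of a, some relation separates it from a;
the conjunction of these relations defines the orbit. *)
Lemma orbit_inf_definable k (a : k.-tuple A) :
  exists alpha, Sigma_definable alpha (orbit_of a).
Proof.
have [u hu] := enum_of_code a (@tuple_code A eA k eA_inj).
have hR i : exists R : query L k,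
    [/\ inf_query R, R A a & R A (u i) -> orbit_of a (u i)].
  case: (pselect (same_inf_type a (u i))) => [s|/not_same_inf_type[R [q ra nr]]].
    exists (@qtrue L k); split=> // [|_].
      by exists ozero; apply/Sig_rank0; [apply: ole_refl|apply: Qf_true].
    apply: (orbit_of_symmetric_forth eA_inj same_inf_type_sym same_inf_type_forth) s.
    move=> m x y h R qR; apply: h; exists ozero.
    by apply/Sig_rank0 => //; apply: ole_refl.
  by exists R; split=> // /nr.
have [R RP] := choice hR.
have [|alpha s] := @inf_forall k R; first by move=> i; have [] := RP i.
exists alpha; apply/Sigma_definableP; exists (fun M e => forall i, R i M e); split=> // b.
split=> [[g [iso ->]] i|r].
  have [[al [phi [_ d]]] ra _] := RP i.
  exact: (proj1 (query_iso a (ex_intro _ phi d) iso) ra).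
by have [i ib] := hu b; have [_ _ orb] := RP i; rewrite -ib; apply: orb; rewrite ib.
Qed.

Theorem orbits_definable_exists : exists alpha, orbits_definable A alpha.
Proof.
(* The supremum is indexed by codes of tuples: n codes the length and the list of
   the codes of the entries. *)
have h n : exists alpha, forall a : (cfst n).-tuple A,
    cseq (map eA a) = csnd n -> Sigma_definable alpha (orbit_of a).
  case: (pselect (exists a : (cfst n).-tuple A, cseq (map eA a) = csnd n)) => [[a ea]|na].
    have [alpha s] := orbit_inf_definable a; exists alpha => b eb.
    by rewrite (tuple_code eA_inj (etrans eb (esym ea))).
  by exists ozero => a ea; case: na; exists a.
have [f hf] := choice h.
exists (Osup f) => k a; pose n := cpair k (cseq (map eA a)).
have /Sigma_definableP[R [s hR]] : Sigma_definable (f n) (orbit_of a).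
  have := hf n; rewrite {2 3 4 5 6 7}/n cfst_pair csnd_pair; exact.
apply/Sigma_definableP; exists R; split=> //; apply: Sig_mono s.
apply: olt_le; apply/olt_sup; exists n; exact: ole_refl.
Qed.

Lemma Scott_rankP : is_Scott_rank A (Scott_rank A).
Proof.
apply: (@xgetPex _ ozero [set alpha | is_Scott_rank A alpha]).
apply: contrapT => nex; have [alpha] := orbits_definable_exists.
elim/(well_founded_ind olt_wf): alpha => alpha IH h; apply: nex; exists alpha.
by split=> // beta hb; case: (ole_olt_total alpha beta) => // /IH /(_ hb).
Qed.

End ScottAnalysis.

(** * Omitting types *)

Definition agree L (M N : structure L) n (e : n.-tuple M) (f : n.-tuple N)
    (l : seq {s : symb L & (arity s).-tuple 'I_n}) : Prop :=
  (forall i j, tnth e i = tnth e j <-> tnth f i = tnth f j) /\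
  (forall z, z \in l -> rel_of (map_tuple (tnth e) (tagged z)) <->
                       rel_of (map_tuple (tnth f) (tagged z))).

Lemma agree_sub L (M N : structure L) n (e : n.-tuple M) (f : n.-tuple N) l l' :
  {subset l <= l'} -> agree e f l' -> agree e f l.
Proof. by move=> sub [heq hrel]; split=> // z /sub/hrel. Qed.

(** A finitary quantifier-free formula depends on finitely many relational atoms,
and on which of the finitely many variables are equal. *)
Lemma qf_support L n (phi : formula L n) : finitary_qf phi ->
  exists l, forall (M N : structure L) (e : n.-tuple M) (f : n.-tuple N),
    agree e f l -> sat phi e <-> sat phi f.
Proof.
have family m (J : set nat) (phi' : nat -> formula L m) : finite_set J ->
  (forall j, J j -> exists l, forall (M N : structure L) (e : m.-tuple M) (f : m.-tuple N),
    agree e f l -> sat (phi' j) e <-> sat (phi' j) f) ->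
  exists l, forall (M N : structure L) (e : m.-tuple M) (f : m.-tuple N),
    agree e f l -> forall j, J j -> sat (phi' j) e <-> sat (phi' j) f.
  move=> /finite_seqP[js ->] IH.
  have IH' j : exists l, j \in js ->
      forall (M N : structure L) (e : m.-tuple M) (f : m.-tuple N),
      agree e f l -> sat (phi' j) e <-> sat (phi' j) f.
    case: (pselect (j \in js)) => [/IH[l hl]|nj]; first by exists l.
    by exists [::].
  have [l hl] := choice IH'.
  exists (flatten (map l js)) => M N e f ag j jj; apply: hl => //.
  apply: agree_sub ag => z zl; apply/flattenP; exists (l j) => //.
  exact: map_f.
elim=> {n phi} n.
- move=> s v; exists [:: existT _ s v] => M N e f [_ /(_ (existT _ s v))].
  by rewrite mem_head; apply.
- by move=> i j; exists [::] => M N e f [heq _]; apply: heq.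
- by move=> phi _ [l hl]; exists l => M N e f ag /=; rewrite (hl _ _ _ _ ag).
- move=> J phi /family fam _ /fam[l hl]; exists l => M N e f /hl ag /=.
  by split=> h j Jj; apply/ag => //; apply: h.
- move=> J phi /family fam _ /fam[l hl]; exists l => M N e f /hl ag /=.
  by split=> -[j [Jj h]]; exists j; split=> //; apply/ag.
Qed.

(** Counted from the end of the list, an entry keeps its index when the list
grows. *)
Fixpoint entry (T : Type) (s : seq T) (l : nat) : option T :=
  if s is x :: s' then if l == size s' then Some x else entry s' l else None.

Lemma entry_hist T (u : nat -> T) l t : l < t -> entry (hist u t) l = Some (u l).
Proof.
elim: t => //= t IH; rewrite ltnS leq_eqVlt size_hist.
by case: eqP => [->|_ /IH].
Qed.

Section OmittingTypes.
Variables (L : language) (A : structure L) (x0 : A).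
Variables (alpha : ord) (k : nat) (a : k.-tuple A).
Hypothesis alpha_ge1 : ole (ofin 1) alpha.

(** A term of the Henkin theory: a relation, Pi of rank below [alpha], applied to
constants, which are natural numbers. The bound on the rank makes what finitely
many items say about a tuple of constants a Sigma [alpha] relation. *)
Record item := Item {
  iarity : nat;
  iquery : query L iarity;
  iargs : iarity.-tuple nat;
  irank : ord;
  irank_lt : olt irank alpha;
  iquery_Pi : Pi irank iquery }.

Definition holds (M : structure L) (sigma : nat -> M) (it : item) : Prop :=
  @iquery it M (map_tuple sigma (iargs it)).

Definition holds_all (M : structure L) (sigma : nat -> M) (s : seq item) : Prop :=
  forall it, List.In it s -> holds sigma it.

Lemma holds_all_cons (M : structure L) (sigma : nat -> M) it s :
  holds_all sigma (it :: s) <-> holds sigma it /\ holds_all sigma s.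
Proof.
split=> [h|[h hs] it' /= [<-|/hs]] //; split; first by apply: h; left.
by move=> it' h'; apply: h; right.
Qed.

Lemma olt0 : olt ozero alpha.
Proof. exact: alpha_ge1. Qed.

Lemma eq_map_below (M : Type) (sigma tau : nat -> M) n (v : n.-tuple nat) N :
  (forall i, tnth v i < N) -> (forall i, i < N -> sigma i = tau i) ->
  map_tuple sigma v = map_tuple tau v.
Proof. by move=> lt e; apply: eq_from_tnth => i; rewrite !tnth_map e. Qed.

Lemma tuple_bound n (v : n.-tuple nat) : exists N, forall i, tnth v i < N.
Proof.
exists (\max_(i < n) tnth v i).+1 => i.
by rewrite ltnS; apply: (leq_bigmax i).
Qed.

(** Only finitely many constants occur in s. *)
Lemma holds_all_bound s : exists N, forall (M : structure L) (sigma tau : nat -> M),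
  (forall i, i < N -> sigma i = tau i) -> holds_all sigma s -> holds_all tau s.
Proof.
elim: s => [|it s [N hN]]; first by exists 0 => M sigma tau _ _ it [].
have [N' hN'] := tuple_bound (iargs it).
exists (maxn N N') => M sigma tau e /holds_all_cons[h hs]; apply/holds_all_cons; split.
  rewrite /holds -(@eq_map_below _ sigma tau _ _ N') // => i lt.
  by apply: e; rewrite leq_max lt orbT.
by apply: hN hs => i lt; apply: e; rewrite leq_max lt.
Qed.

Lemma holds_all_Pi N s : exists beta, olt beta alpha /\
  Pi beta (fun M (z : (N.+1).-tuple M) => holds_all (fun i => tnth z (inord i)) s).
Proof.
elim: s => [|it s [b [lt p]]].
  exists ozero; split; first exact: olt0.
  apply/Pi_rank0; first exact: ole_refl.
  by apply: Qf_ext (@Qf_true L N.+1) => M e; split=> // _ it [].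
have [c [lc [lb [li pc]]]] : exists c, olt c alpha /\ ole b c /\ ole (irank it) c /\
    Pi c (@iquery it).
  have li := irank_lt it; have pi := @iquery_Pi it.
  case: (ole_olt_total b (irank it)) => [le|/olt_le le].
    by exists (irank it); split=> //; split=> //; split=> //; apply: ole_refl.
  exists b; split=> //; split; first exact: ole_refl.
  split=> //; exact: Pi_mono pi.
exists c; split=> //.
have := Pi_and (Pi_pull (fun i => inord (tnth (iargs it) i) : 'I_N.+1) pc) (Pi_mono lb p).
apply: Pi_ext => M z; rewrite holds_all_cons /holds.
suff -> : pull (fun i => inord (tnth (iargs it) i) : 'I_N.+1) z =
  map_tuple (fun i => tnth z (inord i)) (iargs it) by [].
by apply: eq_from_tnth => i; rewrite tnth_pull tnth_map.
Qed.

(** What the items of s imply about the constants v: the set of the possible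
values of v. *)
Definition trace (s : seq item) n (v : n.-tuple nat) : query L n := fun M x =>
  exists sigma : nat -> M, holds_all sigma s /\ map_tuple sigma v = x.

(** Quantify existentially over the values of all the constants that occur, and
equate some of them with the arguments. *)
Lemma trace_Sig s n (v : n.-tuple nat) : Sig alpha (trace s v).
Proof.
have [N1 hN1] := holds_all_bound s; have [N2 hN2] := tuple_bound v.
pose N := maxn N1 N2.
have [b [lt p]] := holds_all_Pi N s.
have q : Qf (fun (M : structure L) (e : (N.+1 + n).-tuple M) =>
   forall l : 'I_n, tnth e (lshift n (inord (tnth v l))) = tnth e (rshift N.+1 l)).
  apply: Qf_forall_ord => l; exists (fEq L (lshift n (inord (tnth v l))) (rshift N.+1 l)).
  by split=> //; constructor.
have pq : Pi b (fun (M : structure L) (e : (N.+1 + n).-tuple M) =>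
   forall l : 'I_n, tnth e (lshift n (inord (tnth v l))) = tnth e (rshift N.+1 l)).
  by apply: (Pi_mono (ole0 b)); apply/Pi_rank0 => //; apply: ole_refl.
apply: (@SigI _ _ _ [set 0] (fun=> N.+1) (fun _ M (e : (N.+1 + n).-tuple M) =>
   holds_all (fun i => tnth (pull (lshift n) e) (inord i)) s /\
   forall l : 'I_n, tnth e (lshift n (inord (tnth v l))) = tnth e (rshift N.+1 l))) => //.
  by move=> _ _; exists b; split=> //; apply: Pi_and => //; apply: Pi_pull p.
move=> M x; split=> [[sigma [h e]]|[_ [_ [z [h e]]]]].
  exists 0; split=> //; exists [tuple sigma i | i < N.+1].
  have pullz : forall i, i < N.+1 ->
      tnth (pull (lshift n) (cat_tuple [tuple sigma i | i < N.+1] x)) (inord i) = sigma i.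
    by move=> i lti; rewrite tnth_pull tnth_lshift tnth_mktuple inordK.
  split.
    apply: hN1 h => i lti; rewrite pullz // ltnS; apply: leq_trans (ltnW lti) _.
    exact: leq_maxl.
  move=> l; rewrite -tnth_pull pullz; last first.
    by rewrite ltnS; apply: leq_trans (ltnW (hN2 l)) _; apply: leq_maxr.
  by rewrite tnth_rshift -e tnth_map.
exists (fun i => tnth z (inord i)); split.
  move=> it /h; rewrite /holds.
  suff -> : map_tuple (fun i => tnth (pull (lshift n) (cat_tuple z x)) (inord i)) (iargs it)
    = map_tuple (fun i => tnth z (inord i)) (iargs it) by [].
  by apply: eq_from_tnth => i; rewrite tnth_map tnth_pull tnth_lshift tnth_map.
by apply: eq_from_tnth => l; have := e l; rewrite tnth_lshift tnth_rshift tnth_map.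
Qed.

(** Constants above all those that occur in s and v are free to name the entries
of z. *)
Lemma fresh_names s (sigma : nat -> A) n (v : n.-tuple nat) m (z : m.-tuple A) :
  holds_all sigma s -> exists tau : nat -> A, exists w : m.-tuple nat,
    [/\ holds_all tau s, map_tuple tau v = map_tuple sigma v & map_tuple tau w = z].
Proof.
move=> h; have [N1 hN1] := holds_all_bound s; have [N2 hN2] := tuple_bound v.
pose N := maxn N1 N2.
pose tau i := if i < N then sigma i else nth x0 z (i - N).
exists tau, [tuple N + i | i < m]; split.
- by apply: hN1 h => i lt; rewrite /tau leq_max lt.
- by apply: (@eq_map_below _ _ _ _ _ N2) => // i lt; rewrite /tau leq_max lt orbT.
- apply: eq_from_tnth => i; rewrite tnth_map tnth_mktuple /tau ltnNge leq_addr /=.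
  by rewrite addKn -tnth_nth.
Qed.

(** An item of positive rank, unfolded to a conjunction over j and y of disjunctions
over j' and z. It obliges the construction to supply, for all j and y, some j'
and constants z; the resulting item has rank below [obound]. *)
Record oblig := Oblig {
  oarity : nat;
  oargs : oarity.-tuple nat;
  obound : ord;
  oJ : set nat;
  om : nat -> nat;
  oJ' : nat -> set nat;
  om' : nat -> nat -> nat;
  oquery : forall j j', query L (om' j j' + (om j + oarity)) }.

Definition met (M : structure L) (sigma : nat -> M) (o : oblig) : Prop :=
  forall j, oJ o j -> forall y : (om o j).-tuple M,
  exists j', oJ' o j j' /\ exists z,
    @oquery o j j' M (cat_tuple z (cat_tuple y (map_tuple sigma (oargs o)))).

Definition obounded (o : oblig) : Prop :=
  ole (obound o) alpha /\ forall j j', oJ o j -> oJ' o j j' ->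
    exists beta, olt beta (obound o) /\ Pi beta (@oquery o j j').

(** A disjunction of rank 0 among the conjuncts of R is a quantifier-free formula,
and counts as a disjunction with one disjunct. The bound [osucc gamma] covers
both uses: items, with gamma their rank, and the sentence, with gamma equal to
alpha. *)
Lemma Pi_oblig beta gamma n (R : query L n) (v : n.-tuple nat) :
  ole (ofin 1) beta -> Pi beta R -> ole gamma alpha -> ole (ofin 1) gamma ->
  ole beta (osucc gamma) ->
  exists o : oblig, [/\ obounded o, obound o = gamma &
    forall (M : structure L) (sigma : nat -> M),
      R M (map_tuple sigma v) <-> met sigma o].
Proof.
move=> b1 p ga g1 bg; have [J [m [S [hS hR]]]] := PiE p b1.
pose C j (m' : nat -> nat) := forall j', query L (m' j' + (m j + n)).
have split_j j : exists X : set nat * {m' : nat -> nat & C j m'}, J j ->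
    (forall j', X.1 j' -> exists b', olt b' gamma /\ Pi b' (tagged X.2 j')) /\
    (forall M e, S j M e <-> exists j', X.1 j' /\ exists z, qcat (tagged X.2 j') e z).
  case: (pselect (J j)) => [Jj|nJ]; last first.
    by exists (set0, existT (C j) (fun=> 0) (fun=> @qtrue L _)).
  have [bj [ltj sj]] := hS j Jj.
  have bjg : ole bj gamma by apply/olt_succ; apply: olt_ole_trans ltj bg.
  case: (pselect (ole bj ozero)) => [bj0|/ole1P bj1].
    exists ([set 0], existT (C j) (fun=> 0) (fun=> S j)) => _; split.
      move=> j' _; exists ozero; split; first exact: g1.
      by apply/Pi_rank0; [apply: ole_refl|apply/(Sig_rank0 _ bj0)].
    move=> M e; split=> [h|[j' [_ [z]]]]; last by rewrite /qcat /= cat0_tuple.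
    by exists 0; split=> //; exists [tuple]; rewrite /qcat /= cat0_tuple.
  have [J' [m' [P [hP hSj]]]] := SigE sj bj1.
  exists (J', existT (C j) m' P) => _; split=> // j' /hP[b' [lt' p']].
  by exists b'; split=> //; apply: olt_ole_trans lt' bjg.
pose X j := projT1 (cid (split_j j)).
have hX j := projT2 (cid (split_j j) : {Y | _ Y}).
exists (@Oblig n v gamma J m (fun j => (X j).1) (fun j => tag (X j).2)
         (fun j => tagged (X j).2)); split=> //.
  by split=> // j j' Jj; apply: (proj1 (hX j Jj)).
move=> M sigma; rewrite hR; split=> h j Jj y.
  by have [_ /(_ M (cat_tuple y (map_tuple sigma v)))[+ _]] := hX j Jj; apply; apply: h.
by apply/(proj2 (hX j Jj)); apply: h.
Qed.

Lemma item_oblig (it : item) : ole (ofin 1) (irank it) ->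
  exists o : oblig, [/\ obounded o, obound o = irank it &
    forall (M : structure L) (sigma : nat -> M), holds sigma it <-> met sigma o].
Proof.
move=> r1; apply: Pi_oblig (iquery_Pi it) _ _ _ => //.
  exact: olt_le (irank_lt it).
by apply: olt_le; apply/olt_succ; apply: ole_refl.
Qed.

Variable phi : formula L 0.
Hypothesis phi_Pi : Pi_in (osucc alpha) phi.
Hypothesis phi_A : forall e, @sat L A 0 phi e.

Lemma sentence_oblig : exists o : oblig, [/\ obounded o, obound o = alpha &
    forall (M : structure L) (sigma : nat -> M), sat phi [tuple of [::] : seq M] <-> met sigma o].
Proof.
have [|||||o [ob oa om]] := @Pi_oblig (osucc alpha) alpha 0 (fun M e => sat phi e) [tuple].
- by apply: olt_ge1; apply/olt_succ; apply: ole_refl.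
- by exists phi.
- exact: ole_refl.
- exact: alpha_ge1.
- exact: ole_refl.
exists o; split=> // M sigma; rewrite -om.
by rewrite (tuple0 (map_tuple sigma _)).
Qed.

Let phi_oblig := projT1 (cid sentence_oblig).

Definition oblig_of (it : item) : option oblig :=
  if pselect (ole (ofin 1) (irank it)) is left r1
  then Some (projT1 (cid (item_oblig r1))) else None.

Lemma oblig_ofP it : if oblig_of it is Some o
  then [/\ obounded o, obound o = irank it &
    forall (M : structure L) (sigma : nat -> M), holds sigma it <-> met sigma o]
  else Qf (@iquery it).
Proof.
rewrite /oblig_of; case: pselect => [r1|r0]; first exact: projT2 (cid (item_oblig r1)).
apply/Pi_rank0; last exact: iquery_Pi.
by apply: contrapT => /ole1P.
Qed.

(** The Pi [alpha] type of a is not isolated by a Sigma [alpha] relation, which is what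
allows it to be omitted. *)
Hypothesis unsupported : forall chi : query L k, Sig alpha chi ->
  (exists b, chi A b) ->
  exists b P, [/\ chi A b, Pi alpha P, P A a & ~ P A b].

(** In this order: decide an atomic relation between constants; decide an equation;
meet the obligation of the sentence ([None]) or of the item added at a given
stage, for given j and y; omit the type of a on given constants. *)
Definition requirement : Type :=
  (({r : symb L & (arity r).-tuple nat} + (nat * nat)) +
   ((option nat * nat * seq nat) + k.-tuple nat))%type.

Definition source (o : option nat) (s : seq item) : option oblig :=
  if o is Some l then (if entry s l is Some it then oblig_of it else None) else Some phi_oblig.

Definition decides_at (x : item) (psi : (nat -> A) -> Prop) : Prop :=
  (forall sigma, holds sigma x -> psi sigma) \/
  (forall sigma, holds sigma x -> ~ psi sigma).

Definition is_item (x : item) n (R : query L n) (v : n.-tuple nat) : Prop :=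
  exists b lt p, x = @Item n R v b lt p.

Definition answered (r : requirement) (s : seq item) (x : item) : Prop :=
  match r with
  | inl (inl (existT r v)) => decides_at x (fun sigma => rel_of (map_tuple sigma v))
  | inl (inr (i, j)) => decides_at x (fun sigma => sigma i = sigma j)
  | inr (inl (o, j, ys)) =>
      if source o s is Some ob then
        oJ ob j -> forall y : (om ob j).-tuple nat, y = ys :> seq nat ->
        exists j' z, [/\ oJ' ob j j', olt (irank x) (obound ob) &
          is_item x (@oquery ob j j') (cat_tuple z (cat_tuple y (oargs ob)))]
      else True
  | inr (inr v) => exists P, [/\ Pi alpha P, P A a &
      forall (M : structure L) (sigma : nat -> M),
        holds sigma x -> ~ P M (map_tuple sigma v)]
  end.

(** By the pairing, every requirement is due at arbitrarily late stages, hence also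
after the item that it mentions has been added. *)
Definition due (t : nat) : option requirement := unpickle (cfst t).

Definition satisfiable (s : seq item) : Prop := exists sigma : nat -> A, holds_all sigma s.

Lemma map_cat_tuple (T U : Type) (f : T -> U) m n (y : m.-tuple T) (e : n.-tuple T) :
  map_tuple f (cat_tuple y e) = cat_tuple (map_tuple f y) (map_tuple f e).
Proof. by apply: val_inj; rewrite /= map_cat. Qed.

Lemma Pi_of_qf n (R : query L n) : Qf R -> Pi ozero R.
Proof. by move=> q; apply/Pi_rank0 => //; apply: ole_refl. Qed.

Definition qf_item n (R : query L n) (v : n.-tuple nat) (q : Qf R) : item :=
  Item v olt0 (Pi_of_qf q).

Lemma literal_step s (sigma : nat -> A) n (R : query L n) (v : n.-tuple nat) :
  holds_all sigma s -> Qf R ->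
  exists x, satisfiable (x :: s) /\ decides_at x (fun tau => R A (map_tuple tau v)).
Proof.
move=> h q; case: (pselect (R A (map_tuple sigma v))) => r.
  exists (qf_item v q); split; last by left.
  by exists sigma; apply/holds_all_cons.
exists (qf_item v (Qf_not q)); split; last by right.
by exists sigma; apply/holds_all_cons.
Qed.

Lemma source_met o s ob (sigma : nat -> A) : source o s = Some ob ->
  holds_all sigma s -> met sigma ob /\ obounded ob.
Proof.
case: o => [l|[<-] _] /=.
  case e : (entry s l) => [it|//] eob h.
  have := oblig_ofP it; rewrite eob => -[b _ <-]; split=> //.
  apply: h; elim: s e => //= x s IH; case: ifP => [_ [->]|_ /IH]; first by left.
  by right.
have [b _ <-] := projT2 (cid sentence_oblig); split=> //; exact: phi_A.
Qed.

(** Atoms are decided as they hold under a satisfying assignment. An obligation is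
met by naming the witnesses that A provides. For omission, the trace of s on v
is not a support, so some tuple b in it fails a relation of the type of a; the
failure is witnessed by a relation of smaller rank, which is added. *)
Lemma answer_step s (r : option requirement) : satisfiable s ->
  exists x, satisfiable (x :: s) /\ (if r is Some r' then answered r' s x else True).
Proof.
move=> [sigma h].
have trivial : exists x, satisfiable (x :: s).
  exists (qf_item [tuple] (@Qf_true L 0)); exists sigma.
  exact/holds_all_cons.
case: r => [[[[r v]|[i j]]|[[[o j] ys]|v]]|] /=; last by have [x] := trivial; exists x.
- apply: (literal_step v (R := fun M e => rel_of e) h).
  exists (fRel (ord_tuple (arity r))); split; first by constructor.
  move=> M e /=; suff -> : map_tuple (tnth e) (ord_tuple (arity r)) = e by [].
  by apply: eq_from_tnth => i; rewrite tnth_map tnth_ord_tuple.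
- have [|x [sx dx]] := literal_step [tuple i; j]
    (R := fun (M : structure L) (e : 2.-tuple M) => tnth e ord0 = tnth e ord_max) h.
    by exists (fEq L ord0 ord_max); split=> //; constructor.
  by exists x; split.
- case e : (source o s) => [ob|]; last by have [x] := trivial; exists x.
  have [hob [_ bob]] := source_met e h.
  case: (pselect (oJ ob j /\ size ys == om ob j)) => [[Jj sz]|nJ]; last first.
    have [x sx] := trivial; exists x; split=> // Jj y ey; case: nJ; split=> //.
    by rewrite -ey size_tuple.
  pose y0 : (om ob j).-tuple nat := Tuple sz.
  have [j' [Jj' [z hz]]] := hob j Jj (map_tuple sigma y0).
  have [b [lt p]] := bob j j' Jj Jj'.
  have [tau [w [htau ev ew]]] := fresh_names (cat_tuple y0 (oargs ob)) z h.
  have lta : olt b alpha by apply: olt_ole_trans lt _; have [_ []] := source_met e h.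
  exists (Item (cat_tuple w (cat_tuple y0 (oargs ob))) lta p); split.
    exists tau; apply/holds_all_cons; split=> //.
    by rewrite /holds /= map_cat_tuple ev ew map_cat_tuple.
  move=> _ y ey; have -> : y = y0 by apply: val_inj.
  by exists j', w; split=> //; exists b, lta, p.
- have [|b [P [[tau [htau ev]] pP Pa nPb]]] := unsupported (trace_Sig s v).
    by exists (map_tuple sigma v), sigma.
  have [J [m [S [hS hP]]]] := PiE pP alpha_ge1.
  have [j [Jj [y ny]]] : exists j, J j /\ exists y, ~ qcat (S j) b y.
    apply: contrapT => nex; apply: nPb; apply/hP => j Jj y.
    by apply: contrapT => ny; apply: nex; exists j; split=> //; exists y.
  have [bj [lt sS]] := hS j Jj.
  have [rho [w [hrho ev' ew]]] := fresh_names v y htau.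
  exists (Item (cat_tuple w v) lt (Sig_not sS)); split.
    exists rho; apply/holds_all_cons; split=> //.
    by rewrite /holds /= map_cat_tuple ew ev' ev.
  exists P; split=> // M si; rewrite /holds /= map_cat_tuple => nS /hP/(_ j Jj).
  by move=> /(_ (map_tuple si w)).
Qed.

Lemma satisfiable_nil : satisfiable [::].
Proof. by exists (fun=> x0) => it []. Qed.

Lemma generic_sequence : exists u : nat -> item,
  (forall t, satisfiable (hist u t)) /\
  (forall r l, exists t, l <= t /\ answered r (hist u t) (u t)).
Proof.
have [|s hs|u hu] := @choose_seq item satisfiable
    (fun s x => if due (size s) is Some r then answered r s x else True).
- exact: satisfiable_nil.
- exact: answer_step.
exists u; split=> [t|r l]; first by have [] := hu t.
exists (cpair (pickle r) l); split; first exact: leq_csnd.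
by have [_] := hu (cpair (pickle r) l); rewrite size_hist /due cfst_pair pickleK.
Qed.

Section GenericModel.
Variable u : nat -> item.
Hypothesis u_sat : forall t, satisfiable (hist u t).
Hypothesis u_answers : forall r l, exists t, l <= t /\ answered r (hist u t) (u t).

(** The facts about assignments that finitely many items imply. They form a filter,
consistent by [forced_sat], in which the literals are decided. *)
Definition forced (psi : (nat -> A) -> Prop) : Prop :=
  exists t, forall sigma : nat -> A, holds_all sigma (hist u t) -> psi sigma.

Lemma holds_all_hist t t' (sigma : nat -> A) : t <= t' ->
  holds_all sigma (hist u t') -> holds_all sigma (hist u t).
Proof.
move=> /subnK <-; elim: (t' - t) => //= d IH /holds_all_cons[_]; exact: IH.
Qed.

Lemma forced_mp (psi chi : (nat -> A) -> Prop) :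
  forced psi -> (forall sigma, psi sigma -> chi sigma) -> forced chi.
Proof. by move=> [t h] imp; exists t => sigma /h/imp. Qed.

Lemma forced_true (psi : (nat -> A) -> Prop) : (forall sigma, psi sigma) -> forced psi.
Proof. by exists 0. Qed.

Lemma forced_and psi chi : forced psi -> forced chi ->
  forced (fun sigma => psi sigma /\ chi sigma).
Proof.
move=> [t h] [t' h']; exists (maxn t t') => sigma hs.
split; [apply: h|apply: h'].
  by apply: (holds_all_hist _ hs); apply: leq_maxl.
by apply: (holds_all_hist _ hs); apply: leq_maxr.
Qed.

Lemma forced_all (I : eqType) (s : seq I) (psi : I -> (nat -> A) -> Prop) :
  (forall i, i \in s -> forced (psi i)) ->
  forced (fun sigma => forall i, i \in s -> psi i sigma).
Proof.
elim: s => [_|i s IH h]; first exact: forced_true.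
have [|j js|f] := forced_and (h i _) (IH _); first exact: mem_head.
  by apply: h; rewrite inE js orbT.
by move=> hf; exists f => sigma /hf[h1 h2] j; rewrite inE => /orP[/eqP->|/h2].
Qed.

Lemma forced_ord n (psi : 'I_n -> (nat -> A) -> Prop) :
  (forall i, forced (psi i)) -> forced (fun sigma => forall i, psi i sigma).
Proof.
move=> h; apply: forced_mp (@forced_all _ (enum 'I_n) psi _) _ => [i _|sigma hs i].
  exact: h.
by apply: hs; rewrite mem_enum.
Qed.

Lemma forced_sat psi : forced psi -> exists sigma, psi sigma.
Proof. by move=> [t h]; have [sigma /h] := u_sat t; exists sigma. Qed.

Lemma forced_holds t : forced (fun sigma => holds sigma (u t)).
Proof. by exists t.+1 => sigma /holds_all_cons[]. Qed.

Lemma decides_forced t psi : decides_at (u t) psi ->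
  forced psi \/ forced (fun sigma => ~ psi sigma).
Proof.
by case=> h; [left|right]; apply: forced_mp (forced_holds t) h.
Qed.

Lemma decided_rel r (v : (arity r).-tuple nat) :
  forced (fun sigma => rel_of (map_tuple sigma v)) \/
  forced (fun sigma => ~ rel_of (map_tuple sigma v)).
Proof.
by have [t [_ /= h]] := u_answers (inl (inl (existT _ r v))) 0; apply: decides_forced h.
Qed.

Lemma decided_eq i j :
  forced (fun sigma => sigma i = sigma j) \/ forced (fun sigma => ~ sigma i = sigma j).
Proof.
by have [t [_ /= h]] := u_answers (inl (inr (i, j))) 0; apply: decides_forced h.
Qed.

Definition ceq i j : bool := `[<forced (fun sigma => sigma i = sigma j)>].

Lemma ceq_refl i : ceq i i.
Proof. by apply/asboolP; apply: forced_true. Qed.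

Lemma ceq_sym i j : ceq i j -> ceq j i.
Proof. by move=> /asboolP h; apply/asboolP; apply: forced_mp h _. Qed.

Lemma ceq_trans i j l : ceq i j -> ceq j l -> ceq i l.
Proof.
move=> /asboolP h /asboolP h'; apply/asboolP.
by apply: forced_mp (forced_and h h') _ => sigma [-> ->].
Qed.

(** The choice of a representative only depends on the class, so that constants
forced to be equal denote the same element. *)
Definition rep i : nat := xchoose (ex_intro (fun j => ceq i j) i (ceq_refl i)).

Lemma ceq_rep i : ceq i (rep i).
Proof. exact: (xchooseP (ex_intro (fun j => ceq i j) i (ceq_refl i))). Qed.

Lemma rep_eq i j : ceq i j -> rep i = rep j.
Proof.
move=> e; apply: eq_xchoose => l; apply/idP/idP; last exact: ceq_trans.
by apply: ceq_trans; apply: ceq_sym.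
Qed.

Definition univB : Type := {i : nat | rep i == i}.

Definition cst (i : nat) : univB :=
  exist _ (rep i) (introT eqP (esym (rep_eq (ceq_rep i)))).

Lemma cstK (b : univB) : cst (val b) = b.
Proof. by apply: val_inj; exact: eqP (valP b). Qed.

Definition modelB : structure L := @Structure L univB
  (fun r t => forced (fun sigma => rel_of (map_tuple sigma (map_tuple val t)))).

Lemma cst_eq i j : cst i = cst j <-> ceq i j.
Proof.
split=> [/(congr1 val)/= e|/rep_eq e]; last exact: val_inj.
by apply: ceq_trans (ceq_rep i) _; rewrite e; apply: ceq_sym; apply: ceq_rep.
Qed.

Lemma countable_modelB : countable [set: modelB].
Proof. by apply/countable_injP; exists val => b b' _ _; apply: val_inj. Qed.

Lemma forced_rel_cst r (v : (arity r).-tuple nat) :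
  forced (fun sigma => rel_of (map_tuple sigma v) <-> @rel_of L modelB r (map_tuple cst v)).
Proof.
have same : forced (fun sigma => forall i : 'I_(arity r),
    sigma (tnth v i) = sigma (rep (tnth v i))).
  by apply: forced_ord => i; have /asboolP := ceq_rep (tnth v i).
have valcst : map_tuple val (map_tuple cst v) = map_tuple rep v.
  by apply: eq_from_tnth => i; rewrite !tnth_map.
have eqv (sigma : nat -> A) :
    (forall i : 'I_(arity r), sigma (tnth v i) = sigma (rep (tnth v i))) ->
    map_tuple sigma (map_tuple rep v) = map_tuple sigma v.
  by move=> e; apply: eq_from_tnth => i; rewrite !tnth_map e.
case: (decided_rel v) => h; apply: forced_mp (forced_and same h) _ => sigma [e hr].
  split=> // _; rewrite /= valcst.
  by apply: forced_mp (forced_and same h) _ => tau [/eqv -> ].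
split=> // /=; rewrite valcst => h'; exfalso.
by have [tau [[/eqv -> ]]] := forced_sat (forced_and (forced_and same h') h).
Qed.

(** By finite support, A under a suitable assignment and the model agree on all
atoms that matter. *)
Lemma qf_modelB n (R : query L n) (v : n.-tuple nat) : Qf R ->
  forced (fun sigma => R A (map_tuple sigma v)) -> R modelB (map_tuple cst v).
Proof.
move=> [psi [q d]] h; have [l hl] := qf_support q.
have heq : forced (fun sigma => forall i j,
    tnth (map_tuple sigma v) i = tnth (map_tuple sigma v) j <->
    tnth (map_tuple cst v) i = tnth (map_tuple cst v) j).
  apply: forced_ord => i; apply: forced_ord => j.
  have [e|e] := decided_eq (tnth v i) (tnth v j); apply: (forced_mp e) => sigma he;
    rewrite !tnth_map cst_eq.
    by split=> // _; apply/asboolP.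
  split=> // /asboolP e'; exfalso.
  by have [tau [ne]] := forced_sat (forced_and e e').
have hrel : forced (fun sigma => forall z, z \in l ->
    rel_of (map_tuple (tnth (map_tuple sigma v)) (tagged z)) <->
    @rel_of L modelB _ (map_tuple (tnth (map_tuple cst v)) (tagged z))).
  apply: forced_all => z _.
  apply: (forced_mp (forced_rel_cst (map_tuple (tnth v) (tagged z)))) => sigma.
  have eq (T : Type) (f : nat -> T) : map_tuple f (map_tuple (tnth v) (tagged z)) =
      map_tuple (tnth (map_tuple f v)) (tagged z).
    by apply: eq_from_tnth => i; rewrite !tnth_map.
  by rewrite !eq.
have [sigma [r [e1 e2]]] := forced_sat (forced_and h (forced_and heq hrel)).
by apply/d; apply/(hl A modelB (map_tuple sigma v) _ (conj e1 e2)); apply/d.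
Qed.

(** By induction on rank: each instance of the obligation of an item is met by a
later item, of smaller rank. *)
Lemma items_modelB t : holds (M := modelB) cst (u t).
Proof.
have [g] : exists g, g = irank (u t) by exists (irank (u t)).
elim/(well_founded_ind olt_wf): g t => g IH t gt.
have := oblig_ofP (u t); case e : (oblig_of (u t)) => [ob|]; last first.
  by move=> q; apply: qf_modelB q _; apply: forced_holds.
case=> _ ob_rank ->; rewrite -ob_rank in gt.
move=> j Jj y; pose w : (om ob j).-tuple nat := map_tuple val y.
have [t' [lt]] := u_answers (inr (inl (Some t, j, val w))) t.+1.
rewrite /= entry_hist // e => /(_ Jj w erefl)[j' [z [Jj' rk [b [l [p eu]]]]]].
exists j'; split=> //; exists (map_tuple cst z).
have := IH (irank (u t')) _ t' erefl; rewrite gt => /(_ rk).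
rewrite eu /holds /= !map_cat_tuple.
suff -> : map_tuple cst w = y by [].
by apply: eq_from_tnth => i; rewrite !tnth_map cstK.
Qed.

Lemma sentence_modelB : sat phi [tuple of [::] : seq modelB].
Proof.
have [_ _ met_phi] := projT2 (cid sentence_oblig).
apply/(met_phi modelB cst) => j Jj y.
pose w : (om phi_oblig j).-tuple nat := map_tuple val y.
have [t' [_]] := u_answers (inr (inl (None, j, val w))) 0.
rewrite /= => /(_ Jj w erefl)[j' [z [Jj' rk [b [l [p eu]]]]]].
exists j'; split=> //; exists (map_tuple cst z).
have := items_modelB t'; rewrite eu /holds /= !map_cat_tuple.
suff -> : map_tuple cst w = y by [].
by apply: eq_from_tnth => i; rewrite !tnth_map cstK.
Qed.

Lemma omits_modelB (b : k.-tuple modelB) :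
  exists P : query L k, [/\ Pi alpha P, P A a & ~ P modelB b].
Proof.
have [t [_ /= [P [pP Pa nP]]]] := u_answers (inr (inr (map_tuple val b))) 0.
exists P; split=> //.
have <- : map_tuple cst (map_tuple val b) = b.
  by apply: eq_from_tnth => i; rewrite !tnth_map cstK.
exact: nP (items_modelB t).
Qed.

End GenericModel.

Theorem omitting_types : exists B : structure L,
  [/\ countable [set: B], sat phi [tuple of [::] : seq B] &
      forall b : k.-tuple B, exists P : query L k, [/\ Pi alpha P, P A a & ~ P B b]].
Proof.
have [u [us ua]] := generic_sequence.
exists (modelB u); split.
- exact: countable_modelB.
- exact: sentence_modelB.
- exact: omits_modelB.
Qed.

End OmittingTypes.

(** * Scott sentences *)

Section ScottSentence.
Variables (L : language) (A : structure L) (eA : A -> nat).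
Hypothesis eA_inj : injective eA.
Variable alpha : ord.
Hypothesis alpha_ge1 : ole (ofin 1) alpha.
Variable phi : formula L 0.
Hypothesis phi_Pi : Pi_in (osucc alpha) phi.
Hypothesis phi_Scott : Scott_sentence A phi.

Definition supports k (chi : query L k) (a : k.-tuple A) : Prop :=
  [/\ Sig alpha chi, chi A a &
      forall b P, chi A b -> Pi alpha P -> P A a -> P A b].

(** Otherwise the type of a is omitted in a countable model of the sentence, that is,
in a copy of A. *)
Lemma exists_support k (a : k.-tuple A) : exists chi, supports chi a.
Proof.
have Acount : countable [set: A] by apply/countable_injP; exists eA => x y _ _; apply: eA_inj.
have A_phi : sat phi [tuple of [::] : seq A].
  by apply/(phi_Scott Acount); exists id; apply: iso_id.
apply: contrapT => nsupp.
case: (pselect (inhabited A)) => [[x0]|nA]; last first.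
  apply: nsupp; exists (@qtrue L k); split=> //.
    by apply: (Sig_mono (ole0 alpha)); apply/Sig_rank0; [apply: ole_refl|apply: Qf_true].
  move=> b P _ _; suff -> : a = b by [].
  by apply: eq_from_tnth => i; case: nA; constructor; apply: tnth a i.
have [|chi sc [b cb]|B [Bcount B_phi omit]] :=
  @omitting_types L A x0 alpha k a alpha_ge1 phi phi_Pi.
- by move=> e; rewrite (tuple0 e).
(* If chi is false of a, then its own negation belongs to the type of a and
   is false of b. *)
- case: (pselect (chi A a)) => [ca|nca]; last first.
    by exists b, (fun M e => ~ chi M e); split=> //; apply: Sig_not.
  apply: contrapT => nex; apply: nsupp; exists chi; split=> // b' P cb' pP Pa.
  by apply: contrapT => nPb; apply: nex; exists b', P.
have [f iso] := proj1 (phi_Scott Bcount) B_phi.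
have [P [[psi [_ d]] Pa]] := omit (map_tuple f a); apply.
exact: (proj1 (query_iso a (ex_intro _ psi d) iso) Pa).
Qed.

Definition same_Sig_type k (a b : k.-tuple A) : Prop :=
  forall R : query L k, Sig alpha R -> R A a <-> R A b.

(** The support gives one inclusion of types; it also makes a support of b true of a,
which gives the other. *)
Lemma supports_same_type k (chi : query L k) a b :
  supports chi a -> chi A b -> same_Sig_type a b.
Proof.
move=> [sc ca supp] cb.
have PiS (P : query L k) : Pi alpha P -> P A a -> P A b by apply: supp.
have SigB (R : query L k) : Sig alpha R -> R A b -> R A a.
  by move=> /Sig_not s Rb; apply: contrapT => /(PiS _ s).
have [chi' [sc' cb' supp']] := exists_support b.
have PiB (P : query L k) : Pi alpha P -> P A b -> P A a.
  by apply: supp'; apply: SigB.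
move=> R s; split; last exact: SigB.
by move=> Ra; apply: contrapT => /(PiB _ (Sig_not s)).
Qed.

Lemma same_Sig_type_forth k (a b : k.-tuple A) : same_Sig_type a b ->
  forall c, exists d, same_Sig_type (cons_tuple c a) (cons_tuple d b).
Proof.
move=> h c; have [chi supp] := exists_support (cons_tuple c a).
have [sc cc _] := supp.
have := h _ (Sig_ex alpha_ge1 (k := 1) (n := k) sc).
have one (x : A) (e : k.-tuple A) : cat_tuple [tuple x] e = cons_tuple x e.
  exact: val_inj.
case=> [[|y]]; first by exists [tuple c]; rewrite /qcat one.
have -> : y = [tuple thead y] by apply: eq_from_tnth => i; rewrite (ord1 i).
by rewrite /qcat one => cy _; exists (thead y); apply: supports_same_type supp cy.
Qed.

Theorem Scott_sentence_orbits_definable : orbits_definable A alpha.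
Proof.
move=> k a; have [chi supp] := exists_support a; have [sc ca _] := supp.
apply/Sigma_definableP; exists chi; split=> // b; split=> [[g [iso ->]]|cb].
  have [psi [_ d]] := sc.
  exact: (proj1 (query_iso a (ex_intro _ psi d) iso) ca).
apply: (orbit_of_symmetric_forth eA_inj _ same_Sig_type_forth) (supports_same_type supp cb).
- by move=> m x y h R s; rewrite h.
- move=> m x y h R q; rewrite (h R) //.
  by apply: (Sig_mono (ole0 alpha)); apply/Sig_rank0 => //; apply: ole_refl.
Qed.

End ScottSentence.

(** * Truth in computable structures *)

Lemma on_cone_dec (D : set nat) : on_cone (fun Z => computable_set Z D).
Proof.
apply: (on_cone_fun (f := fun x => nat_of_bool `[<D x>])).
by apply: on_coneT => Z /computable_setP.
Qed.

Lemma on_cone_cfun f : on_cone (fun Z => cfun Z f).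
Proof. by exists f. Qed.

Lemma dec_queries (qs : nat -> seq nat) (table : nat -> seq bool -> Prop) :
  on_cone (fun Z => forall m S, computable_set (jumps m Z) S ->
    computable_set (jumps m Z) [set x | table x [seq `[<S y>] | y <- qs x]]).
Proof.
apply: on_cone_mp (dec_table (fun x => size (qs x)) (fun x l => nth 0 (qs x) l) table) _.
apply: on_coneT => Z h m S /h; apply: dec_ext => x /=.
suff -> : answers S (fun x l => nth 0 (qs x) l) x (size (qs x)) =
  [seq `[<S y>] | y <- qs x] by [].
by rewrite -{2}(take_size (qs x)) -(map_nth_iota0 0) // -map_comp.
Qed.

Section TruthSets.
Variable L : language.

Definition code (B : nat_structure L) (s : seq (univ B)) : nat :=
  cseq [seq val u | u <- s].

Lemma code_inj (B : nat_structure L) : injective (@code B).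
Proof. by move=> s t /cseq_inj/(inj_map val_inj). Qed.

Definition lists (B : nat_structure L) : set nat := [set c | exists s, c = @code B s].

Lemma listsP (B : nat_structure L) c : lists B c <-> all (fun x => x \in univ B) (dseq c).
Proof.
split=> [[s ->]|]; first by rewrite cseqK all_map; apply/allP => u _ /=; apply: valP u.
rewrite /lists /= -{2}(dseqK c); elim: (dseq c) => [_|x s IH /= /andP[xB /IH[t et]]].
  by exists [::].
exists (exist _ x xB :: t); rewrite /code /=; congr (cpair _ _).+1.
exact: et.
Qed.

Lemma on_cone_lists : on_cone (fun Z => forall m (B : nat_structure L),
  computable_set (jumps m Z) (univ B) -> computable_set (jumps m Z) (lists B)).
Proof.
apply: on_cone_mp (dec_queries dseq (fun _ => all id)) _.
apply: on_coneT => Z h m B /h; apply: dec_ext => c /=.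
by rewrite listsP all_map; split; apply: sub_all => x /=; rewrite inE.
Qed.

Definition relations (B : nat_structure L) : set nat :=
  [set x | exists (s : symb L) (t : (arity s).-tuple (univ B)),
     x = cpair (pickle s) (code t) /\ nrel t].

Lemma relationsP (B : nat_structure L) (s : symb L) (t : (arity s).-tuple (univ B)) :
  relations B (cpair (pickle s) (code t)) <-> nrel t.
Proof.
split=> [[s' [t' [/cpair_inj[es et] r]]]|r]; last by exists s, t.
have ess : s = s' by apply: (pcan_inj pickleK).
by case: s' / ess {es} t' et r => t' /code_inj/val_inj ->.
Qed.

(** The program for the relations is only correct on codes of tuples of the right
length with entries in B; the guard checks this. *)
Lemma on_cone_relations : on_cone (fun Z => forall B : nat_structure L,
  computable_structure Z B -> computable_set Z (relations B)).
Proof.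
apply: on_cone_mp on_cone_lists _.
apply: (on_cone_mp (on_cone_cfun csnd)).
apply: (on_cone_mp (on_cone_dec [set x | exists s : symb L,
  cfst x = pickle s /\ size (dseq (csnd x)) = arity s])).
apply: on_coneT => Z cD csn cl B [cU [p hp]].
have cG := dec_and cD (dec_preim csn (cl 0 B cU)).
apply: dec_ext (dec_guard (P := relations B) cG _) => [x|]; last first.
  exists p => x [[s [e1 e2]] [t et]].
  have sz : size t == arity s by rewrite -e2 et cseqK size_map.
  have ex : x = cpair (pickle s) (code (Tuple sz)).
    by rewrite -(cpair_eta x) e1 -/(code _) et.
  have := hp s (Tuple sz); rewrite ex /decides relationsP; exact.
split=> [[//]|r]; split=> //; have [s [t [-> _]]] := r; split=> /=.
  by exists s; rewrite !cpairE cseqK size_map size_tuple.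
by exists t; rewrite csnd_pair.
Qed.

Definition pformula := {k : nat & formula L k}.

(** Satisfaction by a list, false if the length is wrong: formulas of varying arity
then share one type, and lengths need no casts. *)
Definition ssat (phi : pformula) (M : structure L) (s : seq M) : Prop :=
  exists t : (tag phi).-tuple M, t = s :> seq M /\ sat (tagged phi) t.

Lemma ssat_size phi (M : structure L) (s : seq M) : ssat phi s -> size s = tag phi.
Proof. by move=> [t [<- _]]; rewrite size_tuple. Qed.

Lemma ssat_tuple n (phi : formula L n) (M : structure L) (t : n.-tuple M) :
  ssat (existT _ n phi) t <-> sat phi t.
Proof.
by split=> [[t' [/val_inj ->]]|h]; last by exists t.
Qed.

Lemma ssat_iso phi (M N : structure L) (f : M -> N) s : is_isomorphism f ->
  ssat phi s <-> ssat phi (map f s).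
Proof.
move=> iso; split=> [[t [<- h]]|[t [et h]]].
  by exists (map_tuple f t); split=> //; apply/(sat_iso _ _ iso).
have [g _ [fK gK]] := iso_inv iso.
exists (map_tuple g t); split; first by rewrite /= et mapK.
by apply/(sat_iso _ _ iso); rewrite map_tuple_comp map_tuple_id_in.
Qed.

Definition truths (F : nat -> pformula) (B : nat_structure L) : set nat :=
  [set x | exists s, csnd x = @code B s /\ ssat (M := B) (F (cfst x)) s].

Lemma truthsP F (B : nat_structure L) i (s : seq (univ B)) :
  truths F B (cpair i (code s)) <-> ssat (M := B) (F i) s.
Proof.
rewrite /truths /= !cpairE; split=> [[t [/code_inj ->]]|h] //; by exists s.
Qed.

(** Over the finitely many atoms that matter, truth of the i-th formula is given by a
table that does not depend on B and is part of the oracle. *)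
Lemma qf_truths (F : nat -> pformula) : (forall i, finitary_qf (tagged (F i))) ->
  on_cone (fun Z => forall B : nat_structure L,
    computable_structure Z B -> computable_set Z (truths F B)).
Proof.
move=> qf; have [l hl] : exists l : forall i, seq {s : symb L & (arity s).-tuple 'I_(tag (F i))},
    forall i (M N : structure L) (e : (tag (F i)).-tuple M) (f : (tag (F i)).-tuple N),
    agree e f (l i) -> sat (tagged (F i)) e <-> sat (tagged (F i)) f.
  exists (fun i => projT1 (cid (qf_support (qf i)))) => i.
  exact: projT2 (cid (qf_support (qf i))).
pose q x (z : {s : symb L & (arity s).-tuple 'I_(tag (F (cfst x)))}) : nat :=
  cpair (pickle (tag z)) (cseq [seq nth 0 (dseq (csnd x)) (val i) | i <- tagged z]).
pose qs x := map (@q x) (l (cfst x)).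
(* The table consults any structure with the same answers; by finite support the
   choice makes no difference. *)
pose table x bs := exists (B : nat_structure L) (t : (tag (F (cfst x))).-tuple (univ B)),
  [/\ csnd x = code t, bs = [seq `[<relations B y>] | y <- qs x] &
      @sat L B _ (tagged (F (cfst x))) t].
apply: on_cone_mp on_cone_lists _.
apply: on_cone_mp on_cone_relations _.
apply: (on_cone_mp (dec_queries qs table)).
apply: (on_cone_mp (on_cone_dec [set x | size (dseq (csnd x)) = tag (F (cfst x))])).
apply: (on_cone_mp (on_cone_cfun csnd)).
apply: on_coneT => Z csn cD ct cr cl B cB.
have cU : computable_set Z (univ B) by case: cB.
apply: dec_ext (dec_and (dec_and cD (dec_preim csn (cl 0 B cU))) (ct 0 _ (cr B cB))) => x /=.
have qE (C : nat_structure L) (t : (tag (F (cfst x))).-tuple (univ C)) z : csnd x = code t ->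
    q x z = cpair (pickle (tag z)) (code (map_tuple (tnth t) (tagged z))).
  move=> et; rewrite /q et cseqK /code /= -map_comp; congr (cpair _ (cseq _)).
  apply: eq_map => i /=; rewrite (tnth_nth (tnth t i)) (nth_map (tnth t i)) //.
  by rewrite size_tuple.
split=> [[[sz [s es]] [C [t [et bits sC]]]]|[s [es [t [ets st]]]]].
  have sz' : size s == tag (F (cfst x)) by rewrite -sz es cseqK size_map.
  exists s; split=> //; exists (Tuple sz'); split=> //.
  apply: (proj1 (hl (cfst x) C B t (Tuple sz') _) sC); split=> [i j|z zl].
    have valE (m : 'I_(tag (F (cfst x)))) : val (tnth t m) = val (tnth (Tuple sz') m).
      have eq_codes : map val t = map val s by apply: cseq_inj; rewrite -/(code t) -et es.
      rewrite (tnth_nth (tnth t m)) (tnth_nth (tnth (Tuple sz') m)) /=.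
      rewrite -!(nth_map _ 0) ?eq_codes //; first by rewrite (eqP sz').
      by rewrite size_tuple.
    by split=> e; apply: val_inj; [rewrite -!valE e|rewrite !valE e].
  have ez : `[<relations B (q x z)>] = `[<relations C (q x z)>].
    have: all2 (fun a b => a == b) (map (fun z => `[<relations B (q x z)>]) (l (cfst x)))
       (map (fun z => `[<relations C (q x z)>]) (l (cfst x))).
      by move: bits; rewrite /qs -!map_comp => ->; elim: (map _ _) => //= b bs ->; rewrite eqxx.
    elim: (l (cfst x)) zl => //= z' ls IH; rewrite inE => /orP[/eqP->|zl] /andP[/eqP].
      by [].
    by move=> _; apply: IH.
  have rB := relationsP (map_tuple (tnth (Tuple sz')) (tagged z)).
  have rC := relationsP (map_tuple (tnth t) (tagged z)).
  rewrite -(qE B (Tuple sz') z es) in rB; rewrite -(qE C t z et) in rC.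
  exact: iff_trans (iff_sym rC) (iff_trans (iff_sym (asbool_eq_equiv ez)) rB).
split.
  split; last by exists s.
  by rewrite es cseqK size_map -ets size_tuple.
by exists B, t; rewrite ets.
Qed.

Definition level m (phi : pformula) : Prop := exists alpha,
  ole alpha (ofin m) /\ (Sigma_in alpha (tagged phi) \/ Pi_in alpha (tagged phi)).

Definition signed (b : bool) (P : Prop) : Prop := if b then ~ P else P.

Definition ptrue : pformula := existT _ 0 (fConj set0 (fun=> fAll (fEq L ord0 ord0))).

Lemma level_qf m (phi : pformula) : finitary_qf (tagged phi) -> level m phi.
Proof.
move=> q; exists ozero; split; first exact: ole0.
by left; apply: Sigma_qf => //; apply: ole_refl.
Qed.

Lemma level_ptrue m : level m ptrue.
Proof. by apply: level_qf; constructor=> //; apply: finite_set0. Qed.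

Lemma exists_seq_tuple k n (M : structure L) (e : n.-tuple M) (P : seq M -> Prop) :
  (exists y : k.-tuple M, P (y ++ e)) <->
  exists y : seq M, size (y ++ e) = (k + n)%N /\ P (y ++ e).
Proof.
split=> [[y p]|[y [sz p]]]; first by exists y; rewrite size_cat !size_tuple.
have sy : size y == k by move: sz; rewrite size_cat size_tuple => /addIn ->.
by exists (Tuple sy).
Qed.

Lemma ssat_cat k n (psi : formula L (k + n)) (M : structure L) (y : k.-tuple M) (e : n.-tuple M) :
  ssat (existT _ (k + n)%N psi) (y ++ e) <-> sat psi (cat_tuple y e).
Proof. exact: (ssat_tuple psi (cat_tuple y e)). Qed.

(** Either the formula ([b = false]) or its negation ([b = true]) is a search over
formulas, respectively negated formulas, of the previous level. *)
Definition presented (b : bool) m (phi : pformula) : Prop :=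
  exists (J : set nat) (psi : nat -> pformula),
    (forall j, level m (psi j)) /\
    forall (M : structure L) (e : seq M), size e = tag phi ->
      (signed b (ssat phi e) <-> exists j, J j /\ exists y : seq M,
         size (y ++ e) = tag (psi j) /\ signed b (ssat (psi j) (y ++ e))).

Lemma qf_presented b m (phi : pformula) : finitary_qf (tagged phi) -> presented b m phi.
Proof.
move=> q; exists [set 0], (fun=> phi); split=> [_|M e sz]; first exact: level_qf.
split=> [h|[_ [_ [y [sz']]]]]; first by exists 0; split=> //; exists [::].
move: sz'; rewrite size_cat sz => sz'.
by have -> : y = [::] by apply: size0nil; lia.
Qed.

(** Indices outside J receive a formula as well, as families of formulas are
total. *)
Definition totalize n (J : set nat) (k : nat -> nat)
    (psi : forall j, formula L (k j + n)) j : pformula :=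
  if pselect (J j) then existT _ (k j + n)%N (psi j) else ptrue.

Lemma totalizeE n J k psi j : J j -> @totalize n J k psi j = existT _ (k j + n)%N (psi j).
Proof. by rewrite /totalize; case: pselect. Qed.

Lemma totalize_level n (J : set nat) k (beta : nat -> ord) psi alpha m :
  ole alpha (ofin m.+1) ->
  (forall j, J j -> olt (beta j) alpha /\
     (Sigma_in (beta j) (psi j) \/ Pi_in (beta j) (psi j))) ->
  forall j, level m (@totalize n J k psi j).
Proof.
move=> le h j; rewrite /totalize; case: pselect => [Jj|nJ] /=; last exact: level_ptrue.
have [lt c] := h j Jj.
by exists (beta j); split=> //; apply/olt_succ; apply: olt_ole_trans lt le.
Qed.

Lemma Sigma_presented m alpha (phi : pformula) : ole alpha (ofin m.+1) ->
  Sigma_in alpha (tagged phi) -> presented false m phi.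
Proof.
case: phi => n f le /= s; case: s le => {alpha n f} alpha n.
  by move=> f _ q _; apply: qf_presented.
move=> J k beta psi a1 hpsi le; exists J, (totalize J psi); split.
  by apply: (totalize_level le) => j /hpsi[]; split; [eassumption|right].
move=> M e /= sz; have se : size e == n by apply/eqP.
have -> : e = Tuple se by [].
rewrite ssat_tuple /=; split=> -[j [Jj h]]; exists j; split=> //; rewrite totalizeE // in h *.
  have /sat_fExs[y hy] := h.
  apply/(exists_seq_tuple (k j) (Tuple se) (fun s => ssat (existT _ (k j + n)%N (psi j)) s)).
  by exists y; apply/(ssat_cat (psi j) y (Tuple se)).
apply/sat_fExs.
have /(exists_seq_tuple (k j) (Tuple se) (fun s => ssat (existT _ (k j + n)%N (psi j)) s)) := h.
by move=> [y hy]; exists y; apply/(ssat_cat (psi j) y (Tuple se)).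
Qed.

Lemma Pi_presented m alpha (phi : pformula) : ole alpha (ofin m.+1) ->
  Pi_in alpha (tagged phi) -> presented true m phi.
Proof.
case: phi => n f le /= p; case: p le => {alpha n f} alpha n.
  by move=> f _ q _; apply: qf_presented.
move=> J k beta psi a1 hpsi le; exists J, (totalize J psi); split.
  by apply: (totalize_level le) => j /hpsi[]; split; [eassumption|left].
move=> M e /= sz; have se : size e == n by apply/eqP.
have -> : e = Tuple se by [].
rewrite ssat_tuple /=; split=> [nh|[j [Jj h]] /(_ j Jj)/sat_fAlls nh].
  apply: contrapT => nex; apply: nh => j Jj; apply/sat_fAlls => y.
  apply: contrapT => ny; apply: nex; exists j; split=> //; rewrite totalizeE //.
  apply/(exists_seq_tuple (k j) (Tuple se) (fun s => ~ ssat (existT _ (k j + n)%N (psi j)) s)).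
  by exists y => /(ssat_cat (psi j) y (Tuple se)).
rewrite totalizeE // in h.
have /(exists_seq_tuple (k j) (Tuple se) (fun s => ~ ssat (existT _ (k j + n)%N (psi j)) s)) := h.
by move=> [y]; apply; apply/(ssat_cat (psi j) y (Tuple se)).
Qed.

Lemma level_presented m phi : level m.+1 phi -> exists b, presented b m phi.
Proof.
move=> [alpha [le [s|p]]]; first by exists false; apply: Sigma_presented le s.
by exists true; apply: Pi_presented le p.
Qed.

Lemma dec_signed Z (S : set nat) (b : nat -> bool) : computable_set Z [set x | b x] ->
  computable_set Z S -> computable_set Z [set x | signed (b x) (S x)].
Proof.
move=> cb cS.
apply: dec_ext (dec_and (dec_imp cb (dec_not cS)) (dec_imp (dec_not cb) cS)) => x /=.
rewrite /signed; case: (b x); split.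
- by move=> [h _]; apply: h.
- by move=> nS; split=> // nt; case: nt.
- by move=> [_ h]; apply: h.
- by move=> s; split.
Qed.

(** Membership of the arguments in B is decided separately, since the negation of a
search would otherwise also hold of numbers that code no tuple of B. *)
Theorem level_truths m : forall F : nat -> pformula, (forall i, level m (F i)) ->
  on_cone (fun Z => forall B : nat_structure L,
    computable_structure Z B -> computable_set (jumps m Z) (truths F B)).
Proof.
elim: m => [|m IH] F hF.
  apply: qf_truths => i; have [alpha [le]] := hF i; case: (F i) => n f /= [] h.
    by case: h le => // {alpha n f} alpha n J k beta psi a1 _ /(proj1 (ole1P _) a1).
  by case: h le => // {alpha n f} alpha n J k beta psi a1 _ /(proj1 (ole1P _) a1).
have hX i : exists X : bool * set nat * (nat -> pformula),
    (forall j, level m (X.2 j)) /\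
    forall (M : structure L) (e : seq M), size e = tag (F i) ->
      (signed X.1.1 (ssat (F i) e) <-> exists j, X.1.2 j /\ exists y : seq M,
         size (y ++ e) = tag (X.2 j) /\ signed X.1.1 (ssat (X.2 j) (y ++ e))).
  by have [b [J [psi h]]] := level_presented (hF i); exists (b, J, psi).
have [X XP] := choice hX.
(* All disjuncts of all formulas form one family, indexed by pairs. *)
pose F' z := (X (cfst z)).2 (csnd z).
pose arg v := cseq (dseq (csnd (csnd v)) ++ dseq (csnd (cfst v))).
pose q v := cpair (cpair (cfst (cfst v)) (cfst (csnd v))) (arg v).
pose D1 : set nat := [set v | (X (cfst (cfst v))).1.2 (cfst (csnd v)) /\
   size (dseq (arg v)) = tag (F' (cpair (cfst (cfst v)) (cfst (csnd v))))].
pose D2 : set nat := [set x | size (dseq (csnd x)) = tag (F (cfst x))].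
have := IH F' (fun z => proj1 (XP (cfst z)) (csnd z)).
move/on_cone_mp; apply.
apply: on_cone_mp on_cone_lists _.
apply: (on_cone_mp (on_cone_dec D1)); apply: (on_cone_mp (on_cone_dec D2)).
apply: (on_cone_mp (on_cone_dec [set x | (X (cfst x)).1.1])).
apply: (on_cone_mp (on_cone_dec [set v | (X (cfst (cfst v))).1.1])).
apply: (on_cone_mp (on_cone_cfun csnd)); apply: (on_cone_mp (on_cone_cfun q)).
apply: (on_cone_mp (on_cone_cfun (fun v => csnd (csnd v)))).
apply: on_coneT => Z csn2 cq csn cb' cb cD2 cD1 cl cT B cB.
have cU : computable_set Z (univ B) by case: cB.
set Y := jumps m Z in cT.
have cS : computable_set Y [set v | D1 v /\ (lists B (csnd (csnd v)) /\
    signed (X (cfst (cfst v))).1.1 (truths F' B (q v)))].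
  apply: dec_and; first exact: dec_jumps.
  apply: dec_and; first exact: dec_jumps (dec_preim csn2 (cl 0 B cU)).
  apply: (dec_signed); first exact: dec_jumps.
  by apply: dec_preim (cT B cB); apply: cfun_jumps.
have cE := dec_jump cS; rewrite -/(jumps m.+1 Z) in cE.
apply: dec_ext (dec_and (dec_jumps m.+1 (dec_and cD2 (dec_preim csn (cl 0 B cU))))
  (dec_signed (dec_jumps m.+1 cb) cE)) => x /=.
pose W w := D1 (cpair x w) /\ (lists B (csnd (csnd (cpair x w))) /\
  signed (X (cfst (cfst (cpair x w)))).1.1 (truths F' B (q (cpair x w)))).
have main (e : seq (univ B)) : csnd x = code e -> size e = tag (F (cfst x)) ->
    (exists w, W w) <-> signed (X (cfst x)).1.1 (ssat (M := B) (F (cfst x)) e).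
  move=> ex sz; apply: iff_trans (iff_sym (proj2 (XP (cfst x)) B e sz)).
  have argE w y : csnd w = code y -> arg (cpair x w) = code (y ++ e).
    by move=> ew; rewrite /arg !cpairE ew ex !cseqK /code map_cat.
  have truthE w y : csnd w = code y -> truths F' B (q (cpair x w)) <->
      ssat (M := B) ((X (cfst x)).2 (cfst w)) (y ++ e).
    by move=> ew; rewrite /q (argE w y ew) !cfst_pair csnd_pair truthsP /F' !cpairE.
  split=> [[w []]|[j [Jj [y [szy sg]]]]].
    rewrite /D1 /= !cpairE => -[Jw sw] [[y ey] sg]; exists (cfst w); split=> //; exists y.
    move: sw; rewrite (argE w y ey) cseqK size_map /F' !cpairE => sw; split=> //.
    by move: sg; rewrite /signed; case: ifP => _; rewrite (truthE w y ey).
  pose w := cpair j (code y); have ew : csnd w = code y by rewrite csnd_pair.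
  exists w; split; last split.
  - rewrite /D1 /= (argE w y ew) /F' !cpairE cseqK size_map; split=> //.
  - by rewrite !csnd_pair; exists y.
  - move: sg; rewrite !cfst_pair /signed.
    by case: ifP => _; rewrite (truthE w y ew) cfst_pair.
have signedK b P Q : (P <-> signed b Q) -> signed b P <-> Q.
  by rewrite /signed; case: b => -[h1 h2]; split=> [np|hq];
    [apply: contrapT => /h2|move=> p; apply: h1 p hq|exact: h1|exact: h2].
split=> [[[sz [e ex]] sg]|[e [ex he]]].
  have sz' : size e = tag (F (cfst x)) by rewrite -sz ex cseqK size_map.
  by exists e; split=> //; apply: (proj1 (signedK _ _ _ (main e ex sz'))).
have sz := ssat_size he; split; first split.
- by rewrite /D2 /= ex cseqK size_map.
- by exists e.
- exact: (proj2 (signedK _ _ _ (main e ex sz))).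
Qed.

End TruthSets.

(** * Computable back and forth *)

Definition element (S : set nat) x (Sx : S x) : set_type S :=
  exist (fun x => x \in S) x (mem_set Sx).

Section EffectiveBackAndForth.
Variables (L : language) (A : structure L) (eA : A -> nat).
Hypothesis eA_inj : injective eA.

Definition extendible (B C : structure L) (s : seq (B * C)) : Prop :=
  exists h : B -> C, is_isomorphism h /\ [seq h b | b <- unzip1 s] = unzip2 s.

Definition pcode (B C : nat_structure L) (s : seq (univ B * univ C)) : nat :=
  cpair (code (unzip1 s)) (code (unzip2 s)).

(** Both lists lie over the orbit of a in A, so automorphisms of A join them. *)
Lemma extendible_family (B C : structure L) (phi : pformula L) (a : seq A) s :
  isomorphic A B -> isomorphic A C ->
  (forall b : seq A, ssat phi b <-> exists g : A -> A, is_isomorphism g /\ b = map g a) ->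
  ssat phi (@unzip1 B C s) -> ssat phi (unzip2 s) -> extendible s.
Proof.
move=> [hB iB] [hC iC] orb s1 s2.
have [gB iB' [hBK gBK]] := iso_inv iB; have [gC iC' [hCK gCK]] := iso_inv iC.
have [g [ig eg]] := proj1 (orb _) (proj1 (ssat_iso phi (unzip1 s) iB') s1).
have [g' [ig' eg']] := proj1 (orb _) (proj1 (ssat_iso phi (unzip2 s) iC') s2).
have [k ik [gK kK]] := iso_inv ig.
exists (hC \o g' \o k \o gB); split.
  by do 3 (apply: iso_comp => //).
transitivity (map (hC \o g' \o k) (map gB (unzip1 s))); first by rewrite -map_comp.
rewrite eg -map_comp; transitivity (map hC (map g' a)).
  by rewrite -map_comp; apply: eq_map => x /=; rewrite gK.
by rewrite -eg' mapK.
Qed.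

(** Each list of elements of A is coded by some i, and J i and psi then present the
definition of its orbit. For other numbers i the set J i is empty. *)
Lemma orbit_family n : 0 < n -> orbits_definable A (ofin n) ->
  exists (N : nat -> nat) (J : nat -> set nat) (psi : nat -> pformula L),
    (forall z, level n.-1 (psi z)) /\
    forall B C : structure L, isomorphic A B -> isomorphic A C ->
    forall s : seq (B * C), extendible s <->
      exists i j j' y y', [/\ size s = N i, J i j /\ J i j',
        ssat (psi (cpair i j)) (y ++ unzip1 s) &
        ssat (psi (cpair i j')) (y' ++ unzip2 s)].
Proof.
move=> n0 def.
have hX i : exists X : nat * set nat * (nat -> pformula L),
    (forall j, level n.-1 (X.2 j)) /\
    exists phi : pformula L,
      (forall (M : structure L) (e : seq M), ssat phi e <-> size e = X.1.1 /\
         exists j, X.1.2 j /\ exists y : seq M, ssat (X.2 j) (y ++ e)) /\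
      forall j, X.1.2 j \/ (exists a, cseq (map eA a) = i) ->
       exists a : seq A, cseq (map eA a) = i /\
         forall b : seq A, ssat phi b <-> exists g : A -> A, is_isomorphism g /\ b = map g a.
  case: (pselect (exists a : seq A, cseq (map eA a) = i)) => [[a ea]|na]; last first.
    exists (0, set0, fun=> ptrue L); split=> [j|]; first exact: level_ptrue.
    exists (existT _ 0 (fDisj set0 (fun=> fAll (fEq L ord0 ord0)))); split.
      by move=> M e; split=> [[t [_ [j []]]]|[_ [j []]]].
    by move=> j [].
  have [phi [sig orb]] := def _ (in_tuple a).
  have le : ole (ofin n) (ofin n.-1.+1) by rewrite prednK //; apply: ole_refl.
  have [J [psi [hpsi hphi]]] := @Sigma_presented L n.-1 (ofin n) (existT _ (size a) phi) le sig.
  exists (size a, J, psi); split=> //; exists (existT _ (size a) phi); split.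
    move=> M e; split=> [h|[sz [j [Jj [y h]]]]].
      split; first exact: ssat_size h.
      have [j [Jj [y [_ p]]]] := proj1 (hphi M e (ssat_size h)) h.
      by exists j; split=> //; exists y.
    apply/(hphi M e) => //; exists j; split=> //; exists y; split=> //.
    exact: ssat_size h.
  move=> j _; exists a; split=> // b.
  have orbE (t : (size a).-tuple A) : sat phi t <-> orbit_of (in_tuple a) t by rewrite orb.
  split=> [[t [<- /orbE[g [ig ->]]]]|[g [ig ->]]]; first by exists g.
  by exists (map_tuple g (in_tuple a)); split=> //; apply/orbE; exists g.
have [X XP] := choice hX.
exists (fun i => (X i).1.1), (fun i => (X i).1.2), (fun z => (X (cfst z)).2 (csnd z)).
split=> [z|B C isoB isoC s]; first exact: (proj1 (XP _)).
have sz1 : size (unzip1 s) = size s by rewrite size_map.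
have sz2 : size (unzip2 s) = size s by rewrite size_map.
split=> [[h [ih eh]]|[i [j [j' [y [y' [sz [Jj Jj'] p p']]]]]]]; last first.
  have [_ [phi [hphi /(_ j)[|a [_ orb]]]]] := XP i; first by left.
  rewrite !cpairE in p p'.
  apply: extendible_family isoB isoC orb _ _; apply/hphi; rewrite ?sz1 ?sz2; split=> //.
    by exists j; split=> //; exists y.
  by exists j'; split=> //; exists y'.
have [hB iB] := isoB; have [gB iB' [hBK gBK]] := iso_inv iB.
pose a := map gB (unzip1 s); pose i := cseq (map eA a).
have [_ [phi [hphi /(_ 0)[|a' [ea orb]]]]] := XP i; first by right; exists a.
have {ea} ea : a' = a by apply: (inj_map eA_inj); apply: cseq_inj.
subst a'.
have pa : ssat phi a.
  by apply/orb; exists id; rewrite map_id; split=> //; apply: iso_id.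
have ps1 : ssat phi (unzip1 s).
  by move/(ssat_iso phi a iB): pa; rewrite mapK.
have ps2 : ssat phi (unzip2 s).
  by rewrite -eh; apply/(ssat_iso phi _ ih).
have [sz [j [Jj [y p]]]] := proj1 (hphi _ _) ps1.
have [_ [j' [Jj' [y' p']]]] := proj1 (hphi _ _) ps2.
by exists i, j, j', y, y'; rewrite !cpairE -sz1.
Qed.

(** The search ranges over common definitions together with witnesses for both
lists. *)
Lemma extendible_dec n : 0 < n -> orbits_definable A (ofin n) ->
  on_cone (fun Z => forall B C : nat_structure L,
    computable_copy Z A B -> computable_copy Z A C ->
    exists D, computable_set (jumps n.-1 Z) D /\
      forall s : seq (univ B * univ C),
        @extendible B C s <-> exists w, D (cpair (pcode s) w)).
Proof.
move=> n0 def; have [N [J [psi [hpsi hs]]]] := orbit_family n0 def.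
(* w codes i, then j and y, then j' and y' *)
pose wi w := cfst w.
pose wj w := cfst (cfst (csnd w)). pose wy w := csnd (cfst (csnd w)).
pose wj' w := cfst (csnd (csnd w)). pose wy' w := csnd (csnd (csnd w)).
pose q v := cpair (cpair (wi (csnd v)) (wj (csnd v)))
  (cseq (dseq (wy (csnd v)) ++ dseq (cfst (cfst v)))).
pose q' v := cpair (cpair (wi (csnd v)) (wj' (csnd v)))
  (cseq (dseq (wy' (csnd v)) ++ dseq (csnd (cfst v)))).
pose D0 : set nat := [set v | size (dseq (cfst (cfst v))) = N (wi (csnd v)) /\
   (J (wi (csnd v)) (wj (csnd v)) /\ J (wi (csnd v)) (wj' (csnd v)))].
apply: (on_cone_mp (level_truths hpsi)).
apply: (on_cone_mp (on_cone_dec D0)).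
apply: (on_cone_mp (on_cone_cfun q)); apply: (on_cone_mp (on_cone_cfun q')).
apply: on_coneT => Z cq' cq cD0 cT B C [cB isoB] [cC isoC].
exists [set v | D0 v /\ (truths psi B (q v) /\ truths psi C (q' v))]; split.
  apply: dec_and; first exact: dec_jumps.
  apply: dec_and.
    by apply: dec_preim (cT B cB); apply: cfun_jumps.
  by apply: dec_preim (cT C cC); apply: cfun_jumps.
move=> s; rewrite (hs B C isoB isoC s).
have split_code (X : nat_structure L) (t r : seq (univ X)) c :
    cseq (dseq c ++ dseq (code r)) = code t -> exists y, t = y ++ r.
  rewrite cseqK => /cseq_inj e; exists (take (size (dseq c)) t).
  rewrite -{1}(cat_take_drop (size (dseq c)) t); congr (_ ++ _).
  by apply: (inj_map val_inj); rewrite map_drop -e drop_size_cat.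
split=> [[i [j [j' [y [y' [sz [Jj Jj'] p p']]]]]]|[w [[sz [Jj Jj']] [t1 t2]]]].
  exists (cpair i (cpair (cpair j (code y)) (cpair j' (code y')))).
  rewrite /= /D0 /q /q' /wi /wj /wj' /wy /wy' /pcode /= !cpairE !cseqK !size_map.
  by rewrite -!map_cat !truthsP.
rewrite /pcode !cpairE cseqK !size_map in sz Jj Jj'.
exists (wi w), (wj w), (wj' w).
rewrite /q /q' /pcode !cpairE in t1 t2.
case: t1 => r1; rewrite !cpairE => -[e1 h1].
case: t2 => r2; rewrite !cpairE => -[e2 h2].
have [y ey] := split_code _ _ _ _ e1; have [y' ey'] := split_code _ _ _ _ e2.
by exists y, y'; rewrite -ey -ey'.
Qed.

(** At every stage the pairs chosen so far belong to some isomorphism, so the search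
for the next pair succeeds. The isomorphism is read off from the computed
sequence of stages: b is treated at stage 2b. *)
Theorem computable_isomorphism n : 0 < n -> orbits_definable A (ofin n) ->
  on_cone (fun Z => forall B C : nat_structure L,
    computable_copy Z A B -> computable_copy Z A C ->
    exists f : B -> C, is_isomorphism f /\ computable_map (jumps n.-1 Z) f).
Proof.
move=> n0 def.
pose vt v := cfst (cfst v). pose vz v := csnd (cfst v).
pose vx v := cfst (csnd v). pose vy v := cfst (csnd (csnd v)).
pose vw v := csnd (csnd (csnd v)).
pose up v := cpair (cpair (cfst (csnd v)) (cfst (cfst v))).+1
  (cpair (cfst (csnd (csnd v))) (csnd (cfst v))).+1.
pose qD v := cpair (up (cpair (vz v) (csnd v))) (vw v).
pose E0 : set nat := [set v | ~~ odd (vt v)].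
pose E1 : set nat := [set v | odd (vt v)].
pose X0 : set nat := [set v | vx v = (vt v)./2].
pose Y0 : set nat := [set v | vy v = (vt v)./2].
pose vh v := (vt v)./2.
pose out z := cfst (csnd z).-1.
apply: (on_cone_mp (extendible_dec n0 def)).
apply: (on_cone_mp (on_cone_dec E0)); apply: (on_cone_mp (on_cone_dec E1)).
apply: (on_cone_mp (on_cone_dec X0)); apply: (on_cone_mp (on_cone_dec Y0)).
apply: (on_cone_mp (on_cone_cfun vx)); apply: (on_cone_mp (on_cone_cfun vy)).
apply: (on_cone_mp (on_cone_cfun vh)); apply: (on_cone_mp (on_cone_cfun qD)).
apply: (on_cone_mp (on_cone_cfun up)); apply: (on_cone_mp (on_cone_cfun out)).
apply: (on_cone_mp (on_cone_cfun (fun x => x.*2.+1))).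
apply: on_coneT => Z cdbl cout cup cqD ch cvy cvx cY0 cX0 cE1 cE0 cext B C cB cC.
have [D [cD hD]] := cext B C cB cC.
have [[cUB _] [hB iB]] := cB; have [[cUC _] [hC iC]] := cC.
set Y := jumps n.-1 Z in cD *.
have [gB iB' [hBK gBK]] := iso_inv iB.
have iBC : is_isomorphism (hC \o gB) by apply: iso_comp.
case: (pselect (inhabited (univ B))) => [[b0]|nB]; last first.
  by exists (hC \o gB); split=> //; exists pZero => x; case: nB; constructor.
(* v codes the stage, the lists so far, and the candidate: the two elements of the
   next pair and the witness for [D]. At stage 2i the first element must be i if i
   is in B, at stage 2i+1 the second must be i if i is in C. *)
pose R v := D (qD v) /\ (univ B (vx v) /\ (univ C (vy v) /\
  ((E0 v /\ univ B (vh v) -> X0 v) /\ (E1 v /\ univ C (vh v) -> Y0 v)))).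
have cR : computable_set Y R.
  apply: dec_and; first by apply: dec_preim => //; apply: cfun_jumps.
  apply: dec_jumps; apply: dec_and; first exact: dec_preim cUB.
  apply: dec_and; first exact: dec_preim cUC.
  by apply: dec_and; apply: dec_imp => //; apply: dec_and => //; apply: dec_preim.
have [pR hpR] := dec_not cR.
pose mu v := if pselect (exists w, `[<R (cpair v w)>]) is left ex then ex_minn ex else 0.
have muP v : (exists w, R (cpair v w)) -> R (cpair v (mu v)) /\ eval Y (pMu pR) v (mu v).
  move=> [w0 Rw0]; rewrite /mu; case: pselect => [ex|[]]; last by exists w0; apply/asboolP.
  case: ex_minnP => w /asboolP Rw least; split=> //.
  apply: (@eval_mu _ _ (fun w => R (cpair v w))) => // k lt Rk.
  by have := least k (asboolT Rk); rewrite leqNgt lt.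
pose F := fix F t := if t is t'.+1 then up (cpair (F t') (mu (cpair t' (F t'))))
  else pcode (Nil (univ B * univ C)).
have step s : @extendible B C s -> F (size s) = pcode s ->
    exists p : univ B * univ C, [/\ @extendible B C (p :: s), F (size s).+1 = pcode (p :: s),
      eval Y (pMu pR) (cpair (size s) (F (size s))) (mu (cpair (size s) (F (size s)))),
      (forall b : univ B, size s = (val b).*2 -> p.1 = b) &
      (forall c : univ C, size s = (val c).*2.+1 -> p.2 = c)].
  move=> [h [ih eh]] Fs; set v := cpair (size s) (F (size s)).
  have [k ik [hK kK]] := iso_inv ih.
  have upE (p : univ B * univ C) w :
      up (cpair (F (size s)) (cpair (val p.1) (cpair (val p.2) w))) = pcode (p :: s).
    by rewrite /up Fs /pcode /= !cpairE.
  have RE (p : univ B * univ C) w : R (cpair v (cpair (val p.1) (cpair (val p.2) w))) <->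
    [/\ D (cpair (pcode (p :: s)) w),
      (forall b : univ B, size s = (val b).*2 -> p.1 = b) &
      (forall c : univ C, size s = (val c).*2.+1 -> p.2 = c)].
    rewrite /R /qD /X0 /Y0 /E0 /E1 /vh /vt /vx /vy /vz /vw /= !cpairE upE.
    split=> [[d [_ [_ [hx hy]]]]|[d hx hy]].
      split=> // [b eb|c ec]; apply: val_inj.
        apply: etrans (hx _) _; rewrite eb ?odd_double doubleK //.
        by split=> //; apply: set_mem (valP b).
      apply: etrans (hy _) _; rewrite ec /= ?odd_double uphalf_double //.
      by split=> //; apply: set_mem (valP c).
    split=> //; split; first exact: set_mem (valP p.1).
    split; first exact: set_mem (valP p.2).
    split=> -[od ut].
      rewrite (hx (element ut)) //=.
      by rewrite -[LHS]odd_double_half (negbTE od).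
    rewrite (hy (element ut)) //=.
    by rewrite -[LHS]odd_double_half od.
  have [p [hp p1 p2]] : exists p : univ B * univ C, [/\ h p.1 = p.2,
      (forall b : univ B, size s = (val b).*2 -> p.1 = b) &
      (forall c : univ C, size s = (val c).*2.+1 -> p.2 = c)].
    have [[b eb]|nb] := pselect (exists b : univ B, size s = (val b).*2).
      exists (b, h b); split=> //= [b'|c]; rewrite eb.
        by move/double_inj => e; apply: val_inj.
      by move=> e; exfalso; lia.
    have [[c ec]|nc] := pselect (exists c : univ C, size s = (val c).*2.+1).
      exists (k c, c); split=> //= [b|c']; rewrite ec; first by move=> e; exfalso; lia.
      by move=> [] /double_inj e; apply: val_inj.
    by exists (b0, h b0); split=> //= x ex; [case: nb|case: nc]; exists x.
  have ext : @extendible B C (p :: s) by exists h; split=> //=; rewrite eh hp.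
  have [w Dw] := proj1 (hD _) ext.
  have [Rmu evmu] := muP v (ex_intro (fun w => R (cpair v w)) _ (proj2 (RE p w) (And3 Dw p1 p2))).
  have [p' [w' emu]] : exists (p' : univ B * univ C) w',
      mu v = cpair (val p'.1) (cpair (val p'.2) w').
    have [_ [Ux [Uy _]]] := Rmu; rewrite /vx /vy !csnd_pair in Ux Uy.
    exists (element Ux, element Uy), (csnd (csnd (mu v))).
    by rewrite /= !cpair_eta.
  move: Rmu; rewrite emu RE => -[d' q1 q2]; exists p'; split=> //.
    by apply/hD; exists w'.
  by rewrite /= -/F -/v emu upE.
  by rewrite -emu.
have [||u hu] := @choose_seq (univ B * univ C)
    (fun s => @extendible B C s /\ F (size s) = pcode s)
    (fun s p => [/\ eval Y (pMu pR) (cpair (size s) (F (size s)))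
                      (mu (cpair (size s) (F (size s)))),
      (forall b : univ B, size s = (val b).*2 -> p.1 = b) &
      (forall c : univ C, size s = (val c).*2.+1 -> p.2 = c)]).
- by split=> //; exists (hC \o gB).
- by move=> s [ext Fs]; have [p [e1 e2 e3 e4 e5]] := step s ext Fs; exists p.
have [b|c|t|iso _] := @iso_of_partial L B C u (fun b => (val b).*2) (fun c => (val c).*2.+1) [::].
- by have [_ [_ + _]] := hu (val b).*2; apply; rewrite size_hist.
- by have [_ [_ _ +]] := hu (val c).*2.+1; apply; rewrite size_hist.
- rewrite cats0; have [[[h [[bh hh] eh]] _] _] := hu t.
  have hq q : List.In q (hist u t) -> h q.1 = q.2.
    elim: (hist u t) eh => //= q' s IH [e1 e2] [<-//|]; exact: IH.
  split=> [q q' /hq <- /hq <-|r w hw]; first by split=> [->|/(bij_inj bh)].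
  rewrite hh map_tuple_comp; suff -> : map_tuple (h \o fst) w = map_tuple snd w by [].
  by apply: eq_from_tnth => i; rewrite !tnth_map /= hq.
exists (fun b => (u (val b).*2).2); split=> //.
have cY f : cfun Z f -> cfun Y f by apply: cfun_jumps.
have [pup hup] := cY _ cup; have [pout hout] := cY _ cout; have [pdbl hdbl] := cY _ cdbl.
pose prec := pPrec (pconst (F 0)) (pComp pup (pPair (pComp pSnd pSnd) (pComp (pMu pR) pSnd))).
have evF t : eval Y prec (cpair 0 t) (F t).
  elim: t => [|t IH]; first by constructor; apply: eval_const.
  apply: ev_precS IH _; apply: ev_comp (hup _); constructor.
    by apply: ev_comp (ev_snd _ _ _) (ev_snd _ _ _).
  apply: ev_comp (ev_snd _ _ _) _.
  by have [_ [+ _ _]] := hu t; rewrite size_hist.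
exists (pComp pout (pComp prec (pPair pZero pdbl))) => x.
have -> : val (u (val x).*2).2 = out (F (val x).*2.+1).
  have [[_ +] _] := hu (val x).*2.+1; rewrite size_hist => ->.
  by rewrite /out /pcode /= !cpairE.
apply: ev_comp (hout _); apply: ev_comp (evF _); constructor; [constructor|exact: hdbl].
Qed.

End EffectiveBackAndForth.

Theorem proposition1p1 (L : language) (A : structure L) (n : nat)
    (A_countable : countable [set: A])
    (n_ge1 : 1 <= n)
    (copies : forall Z : set nat, exists B C : nat_structure L,
       computable_copy Z A B /\ computable_copy Z A C /\
       ~ exists f : B -> C, is_isomorphism f /\ computable_map (jumps n.-1 Z) f) :
  (exists (k : nat) (a : k.-tuple A), ~ Sigma_definable (ofin n) (orbit_of a)) /\
  (~ exists phi : formula L 0, Pi_in (ofin n.+1) phi /\ Scott_sentence A phi) /\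
  ole (ofin n.+1) (Scott_rank A).
Proof.
have [eA eA_inj] := countable_code A_countable.
have ndef : ~ orbits_definable A (ofin n).
  move=> def; have [g hg] := computable_isomorphism eA_inj n_ge1 def.
  have [B [C [cB [cC]]]] := copies [set cpair x (g x) | x in setT].
  by apply; apply: hg cB cC; apply: cfun_graph.
split; [|split].
- apply: contrapT => nex; apply: ndef => k a; apply: contrapT => na.
  by apply: nex; exists k, a.
- move=> [phi [phi_Pi phi_Scott]]; apply: ndef.
  exact: (Scott_sentence_orbits_definable eA_inj (ole_ofin1 n_ge1) phi_Pi phi_Scott).
- have [def _] := Scott_rankP eA_inj.
  case: (ole_olt_total (ofin n.+1) (Scott_rank A)) => // /olt_succ le.
  by case: ndef; apply: orbits_definable_mono le def.
Qed.
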